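(* Saturation is inherited by Serre subcategories and by Serre quotients: if $\mathcal A$ is a saturated abelian category and $S$ is a Serre subcategory of $\mathcal A$, then the abelian category $S$ is saturated and the Serre quotient $\mathcal A/S$ is saturated.
   Context: Abelian categories are assumed small (equivalent to one whose objects and morphisms form a set in a fixed Grothendieck universe). A Serre subcategory of an abelian category $\mathcal A$ is a full subcategory closed under subobjects, quotients and extensions; it is itself an abelian category with exact inclusion. $\mathcal A/S$ denotes the Serre quotient by a Serre subcategory $S$, with exact projection $\mathcal A\to\mathcal A/S$ that is the identity on objects. For Serre subcategories $K$ and $S$ of $\mathcal A$, the $S$-saturation $K^S$ of $K$ is the class of objects of $\mathcal A$ that become isomorphic in $\mathcal A/S$ to an object of $K$; equivalently, the class of objects joined to an object of $K$ by a span of morphisms all of whose kernels and cokernels lie in $S$. An abelian category $\mathcal A$ is saturated when for all Serre subcategories $K$ and $S$ of $\mathcal A$ the class $K^S$ is again a Serre subcategory of $\mathcal A$. *)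

(* Defs.v *)
From HB Require Import structures.
From mathcomp Require Import all_boot generic_quotient.
From mathcomp Require Import boolp.

Set Implicit Arguments.
Unset Strict Implicit.
Unset Printing Implicit Defensive.

Declare Scope cat_scope.
Delimit Scope cat_scope with cat.
Local Open Scope cat_scope.
Local Open Scope quotient_scope.

Record category := Category {
  obj :> Type;
  hom : obj -> obj -> Type;
  idm : forall X, hom X X;
  comp : forall X Y Z, hom Y Z -> hom X Y -> hom X Z;
  comp1m : forall X Y (f : hom X Y), comp (idm Y) f = f;
  compm1 : forall X Y (f : hom X Y), comp f (idm X) = f;
  compmA : forall X Y Z T (h : hom Z T) (g : hom Y Z) (f : hom X Y),
    comp h (comp g f) = comp (comp h g) f
}.

Arguments hom {c} X Y.
Arguments idm {c} X.
Arguments comp {c X Y Z} g f.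

(* Classical order: [g \o f] is "g after f". *)
Notation "g \o f" := (comp g f) : cat_scope.

Section CategoryNotions.
Variable C : category.
Implicit Types X Y Z : C.

Definition isomorphic X Y :=
  exists (f : hom X Y) (g : hom Y X), g \o f = idm X /\ f \o g = idm Y.

Definition mono X Y (f : hom X Y) :=
  forall Z (g h : hom Z X), f \o g = f \o h -> g = h.

Definition epi X Y (f : hom X Y) :=
  forall Z (g h : hom Y Z), g \o f = h \o f -> g = h.

Definition zero_object Z :=
  forall X, (exists! f : hom X Z, True) /\ (exists! f : hom Z X, True).

Definition zero_morphism X Y (f : hom X Y) :=
  exists Z (h : hom Z Y) (g : hom X Z), zero_object Z /\ f = h \o g.

Definition is_kernel X Y (f : hom X Y) K (k : hom K X) :=
  zero_morphism (f \o k) /\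
  forall T (h : hom T X), zero_morphism (f \o h) ->
    exists! u : hom T K, k \o u = h.

Definition is_cokernel X Y (f : hom X Y) Q (q : hom Y Q) :=
  zero_morphism (q \o f) /\
  forall T (h : hom Y T), zero_morphism (h \o f) ->
    exists! u : hom Q T, u \o q = h.

Definition is_product X Y P (p1 : hom P X) (p2 : hom P Y) :=
  forall T (f : hom T X) (g : hom T Y),
    exists! u : hom T P, p1 \o u = f /\ p2 \o u = g.

Definition short_exact X Y Z (i : hom X Y) (p : hom Y Z) :=
  is_kernel p i /\ is_cokernel i p.

Record preadditive := Preadditive {
  zerom : forall X Y, hom X Y;
  oppm : forall X Y, hom X Y -> hom X Y;
  addm : forall X Y, hom X Y -> hom X Y -> hom X Y;
  addmA : forall X Y, associative (@addm X Y);
  addmC : forall X Y, commutative (@addm X Y);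
  add0m : forall X Y, left_id (zerom X Y) (@addm X Y);
  addNm : forall X Y, left_inverse (zerom X Y) (@oppm X Y) (@addm X Y);
  compDm : forall X Y Z (g g' : hom Y Z) (f : hom X Y),
    addm g g' \o f = addm (g \o f) (g' \o f);
  compmD : forall X Y Z (g : hom Y Z) (f f' : hom X Y),
    g \o addm f f' = addm (g \o f) (g \o f')
}.

(* The additive structure is only required to exist: for an additive category
   it is unique, so being abelian is a property of the category. *)
Record abelian : Prop := Abelian {
  abelian_add : inhabited preadditive;
  abelian_zero : exists Z, zero_object Z;
  abelian_prod : forall X Y, exists P (p1 : hom P X) (p2 : hom P Y),
    is_product p1 p2;
  abelian_ker : forall X Y (f : hom X Y), exists K (k : hom K X),
    is_kernel f k;
  abelian_coker : forall X Y (f : hom X Y), exists Q (q : hom Y Q),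
    is_cokernel f q;
  abelian_mono : forall X Y (f : hom X Y), mono f ->
    exists Z (g : hom Y Z), is_kernel g f;
  abelian_epi : forall X Y (f : hom X Y), epi f ->
    exists Z (g : hom Z X), is_cokernel g f
}.

(* Full subcategories are given by predicates on objects.  Nonemptiness (i.e.
   containing the zero objects) is part of the notion; closure under
   isomorphism follows from closure under subobjects. *)
Record serre (S : C -> Prop) : Prop := Serre {
  serre_nonempty : exists X, S X;
  serre_sub : forall X Y (i : hom X Y), mono i -> S Y -> S X;
  serre_quo : forall X Y (p : hom X Y), epi p -> S X -> S Y;
  serre_ext : forall X Y Z (i : hom X Y) (p : hom Y Z),
    short_exact i p -> S X -> S Z -> S Y
}.

(* Morphisms whose kernel and cokernel lie in S. *)
Definition serre_iso (S : C -> Prop) X Y (f : hom X Y) :=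
  (exists K (k : hom K X), is_kernel f k /\ S K) /\
  (exists Q (q : hom Y Q), is_cokernel f q /\ S Q).

End CategoryNotions.

Section FullSubcategory.
Variables (C : category) (S : C -> Prop).

Definition full_subcategory : category :=
  @Category {X : C | S X} (fun X Y => hom (sval X) (sval Y))
    (fun X => idm (sval X)) (fun X Y Z g f => g \o f)
    (fun X Y f => comp1m f) (fun X Y f => compm1 f)
    (fun X Y Z T h g f => compmA h g f).

End FullSubcategory.

(* The localization C[W^-1] of Gabriel and Zisman: same objects as C, and
   morphisms the zigzags of arrows of C and formal inverses of arrows of W,
   modulo the congruence generated by the identities and composites of C and
   by the two inverse laws for the arrows of W. *)
Section Localization.
Variables (C : category) (W : forall X Y : C, hom X Y -> Prop).

Inductive zigzag : C -> C -> Type :=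
| ZNil X : zigzag X X
| ZFwd X Y Z : hom X Y -> zigzag Y Z -> zigzag X Z
| ZBwd X Y Z (w : hom Y X) : W w -> zigzag Y Z -> zigzag X Z.

HB.instance Definition _ X Y := gen_eqMixin (zigzag X Y).
HB.instance Definition _ X Y := gen_choiceMixin (zigzag X Y).

Inductive zeq : forall X Y, zigzag X Y -> zigzag X Y -> Prop :=
| zeq_refl X Y (a : zigzag X Y) : zeq a a
| zeq_sym X Y (a b : zigzag X Y) : zeq a b -> zeq b a
| zeq_trans X Y (a b c : zigzag X Y) : zeq a b -> zeq b c -> zeq a c
| zeq_fwd X Y Z (f : hom X Y) (a b : zigzag Y Z) :
    zeq a b -> zeq (ZFwd f a) (ZFwd f b)
| zeq_bwd X Y Z (w : hom Y X) (Ww : W w) (a b : zigzag Y Z) :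
    zeq a b -> zeq (ZBwd Ww a) (ZBwd Ww b)
| zeq_id X Y (a : zigzag X Y) : zeq (ZFwd (idm X) a) a
| zeq_comp X Y Z T (f : hom X Y) (g : hom Y Z) (a : zigzag Z T) :
    zeq (ZFwd f (ZFwd g a)) (ZFwd (g \o f) a)
| zeq_inv_r X Y Z (w : hom X Y) (Ww : W w) (a : zigzag X Z) :
    zeq (ZFwd w (ZBwd Ww a)) a
| zeq_inv_l X Y Z (w : hom Y X) (Ww : W w) (a : zigzag X Z) :
    zeq (ZBwd Ww (ZFwd w a)) a.

Fixpoint zcat X Y (a : zigzag X Y) : forall Z, zigzag Y Z -> zigzag X Z :=
  match a with
  | ZNil _ => fun _ b => b
  | ZFwd _ _ _ f a' => fun _ b => ZFwd f (zcat a' b)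
  | ZBwd _ _ _ _ Ww a' => fun _ b => ZBwd Ww (zcat a' b)
  end.

Lemma zcatz0 X Y (a : zigzag X Y) : zcat a (ZNil Y) = a.
Proof. by elim: a => //= [X' Y' Z' f|X' Y' Z' w Ww] a ->. Qed.

Lemma zcatA X Y (a : zigzag X Y) Z (b : zigzag Y Z) T (c : zigzag Z T) :
  zcat a (zcat b c) = zcat (zcat a b) c.
Proof. by elim: a Z b T c => //= [X' Y' Z' f|X' Y' Z' w Ww] a IHa Z b T c; rewrite IHa.
Qed.

Lemma zeq_catl X Y (a : zigzag X Y) Z (b b' : zigzag Y Z) :
  zeq b b' -> zeq (zcat a b) (zcat a b').
Proof.
elim: a Z b b' => //= [X' Y' Z' f|X' Y' Z' w Ww] a IHa Z b b' eqb.
  by apply: zeq_fwd; apply: IHa.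
by apply: zeq_bwd; apply: IHa.
Qed.

Lemma zeq_catr X Y (a a' : zigzag X Y) Z (b : zigzag Y Z) :
  zeq a a' -> zeq (zcat a b) (zcat a' b).
Proof.
move=> eqa; elim: eqa Z b => /=; try by move=> *; constructor; auto.
by move=> X' Y' a1 a2 a3 _ IH1 _ IH2 Z b; apply: zeq_trans (IH1 _ _) (IH2 _ _).
Qed.

Definition zeqb X Y (a b : zigzag X Y) : bool := `[< zeq a b >].

Lemma zeqb_refl X Y : reflexive (@zeqb X Y).
Proof. by move=> a; apply/asboolP; apply: zeq_refl. Qed.

Lemma zeqb_sym X Y : symmetric (@zeqb X Y).
Proof. by move=> a b; apply/asboolP/asboolP; apply: zeq_sym. Qed.

Lemma zeqb_trans X Y : transitive (@zeqb X Y).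
Proof.
by move=> b a c /asboolP ab /asboolP bc; apply/asboolP; apply: zeq_trans bc.
Qed.

Canonical zeqb_equiv X Y :=
  EquivRel (@zeqb X Y) (@zeqb_refl X Y) (@zeqb_sym X Y) (@zeqb_trans X Y).

Definition loc_hom X Y : Type := {eq_quot (@zeqb X Y)}.

Definition loc_class X Y (a : zigzag X Y) : loc_hom X Y :=
  \pi_{eq_quot (@zeqb X Y)} a.

Definition loc_rep X Y (f : loc_hom X Y) : zigzag X Y :=
  repr (f : {eq_quot (@zeqb X Y)}).

Lemma loc_classE X Y (a b : zigzag X Y) :
  loc_class a = loc_class b <-> zeq a b.
Proof.
split=> [/eqmodP/asboolP //|eqab].
by apply/eqmodP; apply/asboolP.
Qed.

Lemma loc_repK X Y (f : loc_hom X Y) : loc_class (loc_rep f) = f.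
Proof. exact: reprK. Qed.

Lemma loc_classK X Y (a : zigzag X Y) : zeq (loc_rep (loc_class a)) a.
Proof. by apply/loc_classE; rewrite loc_repK. Qed.

Definition loc_id X : loc_hom X X := loc_class (ZNil X).

Definition loc_comp X Y Z (g : loc_hom Y Z) (f : loc_hom X Y) : loc_hom X Z :=
  loc_class (zcat (loc_rep f) (loc_rep g)).

Lemma loc_compE X Y Z (b : zigzag Y Z) (a : zigzag X Y) :
  loc_comp (loc_class b) (loc_class a) = loc_class (zcat a b).
Proof.
apply/loc_classE; apply: zeq_trans (zeq_catl _ (loc_classK b)).
exact: zeq_catr (loc_classK a).
Qed.

Lemma loc_comp1m X Y (f : loc_hom X Y) : loc_comp (loc_id Y) f = f.
Proof. by rewrite -(loc_repK f) loc_compE zcatz0. Qed.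

Lemma loc_compm1 X Y (f : loc_hom X Y) : loc_comp f (loc_id X) = f.
Proof. by rewrite -(loc_repK f) loc_compE. Qed.

Lemma loc_compmA X Y Z T (h : loc_hom Z T) (g : loc_hom Y Z)
  (f : loc_hom X Y) : loc_comp h (loc_comp g f) = loc_comp (loc_comp h g) f.
Proof.
by rewrite -(loc_repK f) -(loc_repK g) -(loc_repK h) !loc_compE zcatA.
Qed.

Definition localization : category :=
  @Category C loc_hom loc_id loc_comp loc_comp1m loc_compm1 loc_compmA.

(* The canonical functor C -> C[W^-1], the identity on objects. *)
Definition loc_proj (X Y : C) (f : hom X Y) : @hom localization X Y :=
  loc_class (ZFwd f (ZNil Y)).

End Localization.

Definition serre_quotient (A : category) (S : A -> Prop) : category :=
  localization (@serre_iso A S).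

Definition saturation (A : category) (S K : A -> Prop) : A -> Prop :=
  fun X => exists Y : A, K Y /\ @isomorphic (serre_quotient S) X Y.

Definition saturated (A : category) : Prop :=
  forall K S : A -> Prop, serre K -> serre S -> serre (saturation S K).

(* Main.v *)
Require Import Defs.
From mathcomp Require Import all_boot boolp.

Set Implicit Arguments.
Unset Strict Implicit.
Unset Printing Implicit Defensive.

Local Open Scope cat_scope.

(** Write [C/S] for the localization of an abelian category [C] at the morphisms
    with kernel and cokernel in [S], and [F] for its projection.

    The quotient is abelian because it has calculi of left and right fractions:
    the inverted morphisms satisfy the Ore condition ([siso_ore]) and are
    cancellable up to precomposition ([cancel_left]), and both properties are
    self-dual up to passing to the opposite category.  The delicate point is
    that equality in a localization presented by zigzags is as fine as
    expected: if [F f = F g] then [f \o t = g \o t] for some inverted [t]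
    ([loc_proj_eq]).  It is proved by letting zigzags act on classes of roofs
    [X <- Z -> Y] by composition on the right-hand end, which respects the
    relations defining the localization; applying two equal zigzags to the
    identity roof gives the result.  Fractions with a common denominator are
    then added in [C] ([loc_preadditive]), and kernels, cokernels and the
    normality of monos and epis are inherited from [C], so that [F] is exact
    ([quotient_abelian], [functor_kernel], [functor_cokernel]).

    For saturation, the main tool is that objects isomorphic in a Serre quotient
    are joined by a span of inverted morphisms ([isomorphic_span]), together
    with the fact that an exact functor [G] preserves and reflects the morphisms
    inverted for [T] and for its preimage under [G] ([exact_siso]).  For the
    inclusion of [S] in [C], the apex of a span joining objects of [S] has its
    kernel and image in [S], hence lies in [S]; therefore saturation in [S] is
    the restriction of saturation in [C] of the same classes
    ([sub_saturated]).  For [F], each leg of a span in [C/S] is a fraction of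
    two morphisms of [C] inverted for the preimage of [T]; therefore saturation
    in [C/S] is the descent of saturation in [C] of the preimages
    ([quotient_saturated]).  Since that class contains [S], it descends to a
    Serre subcategory of [C/S] ([quotient_serre]). *)

(** * Preadditive categories and duality *)

(** The opposite category.  It exchanges [mono] and [epi], and [kernel] and
    [cokernel] below, by conversion; each half of a self-dual statement can so
    be deduced from the other. *)
Definition op (C : category) : category :=
  @Category C (fun X Y => hom Y X) (fun X => idm X)
    (fun X Y Z g f => f \o g) (fun X Y f => compm1 f) (fun X Y f => comp1m f)
    (fun X Y Z T h g f => esym (compmA f g h)).

Definition op_add (C : category) (P : preadditive C) : preadditive (op C) :=
  @Preadditive (op C) (fun X Y => zerom P Y X) (fun X Y f => oppm P f)
    (fun X Y f g => addm P f g) (fun X Y => @addmA C P Y X)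
    (fun X Y => @addmC C P Y X) (fun X Y => @add0m C P Y X)
    (fun X Y => @addNm C P Y X)
    (fun X Y Z g g' f => compmD P f g g') (fun X Y Z g f f' => compDm P f f' g).

Section Preadditive.
Variables (C : category) (P : preadditive C).
Implicit Types X Y Z T : C.

Local Notation "0" := (zerom P _ _) : cat_scope.
Local Notation "f + g" := (addm P f g) : cat_scope.
Local Notation "- f" := (oppm P f) : cat_scope.

Lemma addm0 X Y (f : hom X Y) : f + 0 = f.
Proof. by rewrite addmC add0m. Qed.

Lemma addmN X Y (f : hom X Y) : f + - f = 0.
Proof. by rewrite addmC addNm. Qed.

Lemma addmI X Y (f g h : hom X Y) : f + g = f + h -> g = h.
Proof.
by move=> e; rewrite -[g](add0m P) -[h](add0m P) -(addNm P f) -!addmA e.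
Qed.

Lemma subm_eq0 X Y (f g : hom X Y) : f + - g = 0 -> f = g.
Proof. by rewrite -(addmN g) addmC [g + _]addmC => /addmI. Qed.

Lemma oppm0 X Y : - (0 : hom X Y) = 0.
Proof. by rewrite -[LHS](add0m P) addmN. Qed.

Lemma comp0m X Y Z (f : hom X Y) : (0 : hom Y Z) \o f = 0.
Proof. by apply: (@addmI _ _ (0 \o f)); rewrite -compDm !addm0. Qed.

Lemma compm0 X Y Z (g : hom Y Z) : g \o (0 : hom X Y) = 0.
Proof. by apply: (@addmI _ _ (g \o 0)); rewrite -compmD !addm0. Qed.

Lemma compNm X Y Z (g : hom Y Z) (f : hom X Y) : - g \o f = - (g \o f).
Proof. by apply: (@addmI _ _ (g \o f)); rewrite -compDm !addmN comp0m. Qed.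

Lemma compmN X Y Z (g : hom Y Z) (f : hom X Y) : g \o - f = - (g \o f).
Proof. by apply: (@addmI _ _ (g \o f)); rewrite -compmD !addmN compm0. Qed.

Lemma monoP X Y (f : hom X Y) :
  mono f <-> forall T (h : hom T X), f \o h = 0 -> h = 0.
Proof.
split=> [mf T h fh|zf T g h fgh]; first by apply: mf; rewrite fh compm0.
by apply: subm_eq0; apply: zf; rewrite compmD compmN fgh addmN.
Qed.

(** Kernels and cokernels in terms of a given preadditive structure, with the
    uniqueness of factorizations expressed as a cancellation property. *)
Definition kernel X Y (f : hom X Y) K (k : hom K X) :=
  [/\ f \o k = 0, mono k
    & forall T (h : hom T X), f \o h = 0 -> exists u : hom T K, k \o u = h].

Definition cokernel X Y (f : hom X Y) Q (q : hom Y Q) :=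
  [/\ q \o f = 0, epi q
    & forall T (h : hom Y T), h \o f = 0 -> exists u : hom Q T, u \o q = h].

Lemma zero_objectP Z : zero_object Z <-> idm Z = 0.
Proof.
split=> [zZ|id0 X].
  have [[f [_ uf]] _] := zZ Z.
  by rewrite -(uf (idm Z) I) -(uf 0 I).
split; exists 0; split=> // f _.
  by rewrite -[f]comp1m id0 comp0m.
by rewrite -[f]compm1 id0 compm0.
Qed.

Hypothesis hasZ : exists Z : C, zero_object Z.

Lemma zero_morphismP X Y (f : hom X Y) : zero_morphism f <-> f = 0.
Proof.
split=> [[Z [h [g [/zero_objectP id0 ->]]]]|->].
  by rewrite -[g]comp1m id0 comp0m compm0.
have [Z zZ] := hasZ; exists Z, 0, 0; split=> //.
by rewrite comp0m.
Qed.

Lemma is_kernelP X Y (f : hom X Y) K (k : hom K X) :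
  is_kernel f k <-> kernel f k.
Proof.
split=> [[/zero_morphismP fk uk]|[fk mk uk]].
  split=> // [T g h kgh|T h fh].
    have [|u [_ uu]] := uk T (k \o g).
      by apply/zero_morphismP; rewrite compmA fk comp0m.
    by rewrite -(uu g) // -(uu h).
  have [|u [ku _]] := uk T h; first exact/zero_morphismP.
  by exists u.
split=> [|T h /zero_morphismP /uk [u ku]]; first exact/zero_morphismP.
by exists u; split=> // v kv; apply: mk; rewrite ku kv.
Qed.

Lemma is_cokernelP X Y (f : hom X Y) Q (q : hom Y Q) :
  is_cokernel f q <-> cokernel f q.
Proof.
split=> [[/zero_morphismP fk uk]|[fk mk uk]].
  split=> // [T g h kgh|T h fh].
    have [|u [_ uu]] := uk T (g \o q).
      by apply/zero_morphismP; rewrite -compmA fk compm0.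
    by rewrite -(uu g) // -(uu h).
  have [|u [ku _]] := uk T h; first exact/zero_morphismP.
  by exists u.
split=> [|T h /zero_morphismP /uk [u ku]]; first exact/zero_morphismP.
by exists u; split=> // v kv; apply: mk; rewrite ku kv.
Qed.

End Preadditive.

Lemma epiP (C : category) (P : preadditive C) (X Y : C) (f : hom X Y) :
  epi f <-> forall T (h : hom Y T), h \o f = zerom P _ _ -> h = zerom P _ _.
Proof. exact: (@monoP (op C) (op_add P) Y X f). Qed.

(** The axioms of an abelian category relative to a preadditive structure, in a
    self-dual form: zero objects are the objects whose identity vanishes, and
    products are biproducts. *)
Record abelian_for (C : category) (P : preadditive C) : Prop := AbelianFor {
  ab_zero : exists Z : C, idm Z = zerom P Z Z;
  ab_biprod : forall X Y : C, exists (B : C) (i1 : hom X B) (i2 : hom Y B)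
      (p1 : hom B X) (p2 : hom B Y),
    [/\ p1 \o i1 = idm X, p2 \o i2 = idm Y, p1 \o i2 = zerom P Y X,
        p2 \o i1 = zerom P X Y & addm P (i1 \o p1) (i2 \o p2) = idm B];
  ab_ker : forall (X Y : C) (f : hom X Y), exists K (k : hom K X), kernel P f k;
  ab_coker : forall (X Y : C) (f : hom X Y), exists Q (q : hom Y Q),
    cokernel P f q;
  ab_mono : forall (X Y : C) (f : hom X Y), mono f ->
    exists Z (g : hom Y Z), kernel P g f;
  ab_epi : forall (X Y : C) (f : hom X Y), epi f ->
    exists Z (g : hom Z X), cokernel P g f
}.

Lemma abelian_for_op (C : category) (P : preadditive C) :
  abelian_for P -> abelian_for (op_add P).
Proof.
case=> z b k c m e; split=> //= X Y.
- have [B [i1 [i2 [p1 [p2 [h1 h2 h3 h4 h5]]]]]] := b X Y.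
  by exists B, p1, p2, i1, i2.
- by move=> f; apply: c.
- by move=> f; apply: k.
- by move=> f; apply: e.
- by move=> f; apply: m.
Qed.

Lemma abelian_for_zero (C : category) (P : preadditive C) :
  abelian_for P -> exists Z : C, zero_object Z.
Proof. by case/ab_zero=> Z /zero_objectP; exists Z. Qed.

Lemma abelianP (C : category) :
  abelian C <-> exists P : preadditive C, abelian_for P.
Proof.
split=> [[[P] hz hp hk hc hm he]|[P abP]].
  exists P; split.
  - by have [Z /(zero_objectP P)] := hz; exists Z.
  - move=> X Y; have [B [p1 [p2 hB]]] := hp X Y.
    have [i1 [[a1 b1] _]] := hB X (idm X) (zerom P _ _).
    have [i2 [[a2 b2] _]] := hB Y (zerom P _ _) (idm Y).
    exists B, i1, i2, p1, p2; split=> //.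
    have [u [_ uu]] := hB B p1 p2.
    apply: etrans (esym (uu _ _)) (uu _ _); last by rewrite !compm1.
    by rewrite !compmD !compmA a1 b1 a2 b2 !comp1m !comp0m addm0 add0m.
  - by move=> X Y f; have [K [k /(is_kernelP P hz)]] := hk X Y f; exists K, k.
  - by move=> X Y f; have [K [k /(is_cokernelP P hz)]] := hc X Y f; exists K, k.
  - by move=> X Y f /hm[K [k /(is_kernelP P hz)]]; exists K, k.
  - by move=> X Y f /he[K [k /(is_cokernelP P hz)]]; exists K, k.
have hz := abelian_for_zero abP; case: abP => z b k c m e; split=> //.
- move=> X Y; have [B [i1 [i2 [p1 [p2 [h1 h2 h3 h4 h5]]]]]] := b X Y.
  exists B, p1, p2 => T f g; exists (addm P (i1 \o f) (i2 \o g)); split.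
    by rewrite !compmD !compmA h1 h2 h3 h4 !comp1m !comp0m addm0 add0m.
  by move=> u [<- <-]; rewrite !compmA -compDm h5 comp1m.
- by move=> X Y f; have [K [q /(is_kernelP P hz)]] := k X Y f; exists K, q.
- by move=> X Y f; have [K [q /(is_cokernelP P hz)]] := c X Y f; exists K, q.
- by move=> X Y f /m[K [q /(is_kernelP P hz)]]; exists K, q.
- by move=> X Y f /e[K [q /(is_cokernelP P hz)]]; exists K, q.
Qed.

(** * Exactness in abelian categories *)

Section Exactness.
Variables (C : category) (P : preadditive C).
Implicit Types X Y Z T : C.
Local Notation "0" := (zerom P _ _) : cat_scope.
Local Notation "f + g" := (addm P f g) : cat_scope.
Local Notation "- f" := (oppm P f) : cat_scope.

Lemma mono_comp X Y Z (g : hom Y Z) (f : hom X Y) :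
  mono g -> mono f -> mono (g \o f).
Proof. by move=> mg mf T a b; rewrite -!compmA => /mg/mf. Qed.

Lemma mono_compr X Y Z (g : hom Y Z) (f : hom X Y) : mono (g \o f) -> mono f.
Proof. by move=> mgf T a b e; apply: mgf; rewrite -!compmA e. Qed.

Lemma mono_retract X Y (f : hom X Y) (g : hom Y X) : g \o f = idm X -> mono f.
Proof.
by move=> e T a b /(congr1 (Defs.comp g)); rewrite !compmA e !comp1m.
Qed.

Lemma mono_isomorphic X Y : isomorphic X Y -> exists f : hom X Y, mono f.
Proof. by case=> f [g [gf _]]; exists f; apply: mono_retract gf. Qed.

Lemma isomorphic_sym X Y : isomorphic X Y -> isomorphic Y X.
Proof. by case=> f [g [gf fg]]; exists g, f. Qed.

Lemma isomorphic_trans X Y Z :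
  isomorphic X Y -> isomorphic Y Z -> isomorphic X Z.
Proof.
case=> f [g [gf fg]] [f' [g' [gf' fg']]]; exists (f' \o f), (g \o g'); split.
  by rewrite -compmA [g' \o _]compmA gf' comp1m gf.
by rewrite -compmA [f \o _]compmA fg comp1m fg'.
Qed.

(** Two kernels of the same morphism differ by an isomorphism. *)
Lemma kernel_uniq X Y (f : hom X Y) K (k : hom K X) L (l : hom L X) :
  kernel P f k -> kernel P f l ->
  exists (u : hom K L) (v : hom L K),
    [/\ l \o u = k, v \o u = idm K & u \o v = idm L].
Proof.
move=> [fk mk uk] [fl ml ul]; have [u lu] := ul _ _ fk.
have [v kv] := uk _ _ fl.
exists u, v; split=> //; first by apply: mk; rewrite compmA kv compm1.
by apply: ml; rewrite compmA lu compm1.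
Qed.

Lemma kernel_iso X Y (f : hom X Y) K (k : hom K X) L (u : hom L K)
    (v : hom K L) :
  kernel P f k -> v \o u = idm L -> u \o v = idm K -> kernel P f (k \o u).
Proof.
move=> [fk mk uk] vu uv; split; first by rewrite compmA fk comp0m.
  exact: mono_comp (mono_retract vu).
move=> T h /uk[w kw]; exists (v \o w).
by rewrite -compmA [u \o _]compmA uv comp1m.
Qed.

Hypothesis abP : abelian_for P.

Lemma mono_kernel0 X Y (f : hom X Y) K (k : hom K X) :
  kernel P f k -> k = 0 -> mono f.
Proof.
move=> [_ _ uk] k0; apply/(monoP P) => T h /uk[u <-].
by rewrite k0 comp0m.
Qed.

(** A monomorphism is a kernel of its cokernels. *)
Lemma mono_kernel_coker X Y (f : hom X Y) Q (q : hom Y Q) :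
  mono f -> cokernel P f q -> kernel P q f.
Proof.
move=> mf [qf eq_ uq]; have [Z [g [gf _ uf]]] := ab_mono abP mf.
split=> // T h qh; apply: uf; have [v <-] := uq _ _ gf.
by rewrite -compmA qh compm0.
Qed.

Lemma epi_cokernel_ker X Y (f : hom X Y) K (k : hom K X) :
  epi f -> kernel P f k -> cokernel P k f.
Proof.
move=> mf [qf eq_ uq]; have [Z [g [gf _ uf]]] := ab_epi abP mf.
split=> // T h qh; apply: uf; have [v <-] := uq _ _ gf.
by rewrite compmA qh comp0m.
Qed.

(** Epis are stable under pullback.  The fibre product is the kernel of the
    difference map [d] out of the biproduct of [X] and [Z].  As [d] is epi, it
    is the cokernel of that kernel; so if [h] kills the projection [e'], its
    extension to the biproduct factors as [u \o d].  On [Z] that extension is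
    zero while [d] restricts to [- e], whence [u] and [h] vanish. *)
Lemma pullback_epi X Y Z (f : hom X Y) (e : hom Z Y) : epi e ->
  exists (T : C) (e' : hom T X) (f' : hom T Z),
    [/\ f \o e' = e \o f', epi e'
      & forall U (a : hom U X) (b : hom U Z), f \o a = e \o b ->
          exists! c : hom U T, e' \o c = a /\ f' \o c = b].
Proof.
move=> epe; have [B [i1 [i2 [p1 [p2 [h1 h2 h3 h4 h5]]]]]] := ab_biprod abP X Z.
pose d := (f \o p1) + - (e \o p2).
have di2 : d \o i2 = - e.
  by rewrite compDm compNm -!compmA h2 h3 compm1 compm0 add0m.
have di1 : d \o i1 = f.
  by rewrite compDm compNm -!compmA h1 h4 compm1 compm0 oppm0 addm0.
have epd : epi d.
  apply/(epiP P) => T h hd; apply: (epe); rewrite comp0m.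
  have : h \o d \o i2 = 0 by rewrite hd comp0m.
  rewrite -compmA di2 compmN => /(congr1 (addm P (h \o e))).
  by rewrite addmN addm0.
have [K [k kk]] := ab_ker abP d; have [dk mk uk] := kk.
have [_ _ ck] := epi_cokernel_ker epd kk.
exists K, (p1 \o k), (p2 \o k); split.
- by apply: (@subm_eq0 _ P); rewrite !compmA -compNm -compDm.
- apply/(epiP P) => T h; rewrite compmA => /ck[u hu].
  have u0 : u = 0.
    have : u \o d \o i2 = 0 by rewrite hu -compmA h3 compm0.
    rewrite -compmA di2 compmN => ue; apply: (epe); rewrite comp0m.
    by move/(congr1 (addm P (u \o e))): ue; rewrite addmN addm0.
  by rewrite -[h]compm1 -h1 compmA -hu u0 !comp0m.
move=> U a b fab; have [|c kc] := uk U ((i1 \o a) + (i2 \o b)).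
  by rewrite compmD !compmA di1 di2 fab compNm addmN.
exists c; split.
  rewrite -!compmA kc !compmD !compmA h1 h2 h3 h4 !comp1m !comp0m.
  by rewrite addm0 add0m.
move=> c' [ea eb]; apply: mk; rewrite kc -ea -eb.
by rewrite !compmA -compDm -compDm h5 comp1m.
Qed.

(** The induced morphism from the coimage is mono. *)
Lemma coimage_mono X Y (f : hom X Y) K (k : hom K X) Q (q : hom X Q)
    (m : hom Q Y) :
  kernel P f k -> cokernel P k q -> m \o q = f -> mono m.
Proof.
move=> [fk mk uk] [qk eq_ uq] mq; apply/(monoP P) => T h mh.
have [T' [e [h' [he ee _]]]] := pullback_epi h eq_.
have [|u ku] := uk _ h'; first by rewrite -mq -compmA -he compmA mh comp0m.
by apply: ee; rewrite he -ku compmA qk !comp0m.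
Qed.

Lemma epi_mono_factor X Y (f : hom X Y) : exists (I : C) (q : hom X I)
  (m : hom I Y), [/\ f = m \o q, epi q & mono m].
Proof.
have [K [k kk]] := ab_ker abP f; have [Q [q cq]] := ab_coker abP k.
have [fk _ _] := kk; have [_ eq_ uq] := cq; have [m mq] := uq _ _ fk.
by exists Q, q, m; split=> //; apply: coimage_mono kk cq mq.
Qed.

Lemma kernel_monol X Y Z (m : hom Y Z) (f : hom X Y) K (k : hom K X) :
  mono m -> kernel P (m \o f) k <-> kernel P f k.
Proof.
move=> mm; split=> -[fk mk uk]; split=> //.
- by apply: mm; rewrite compmA fk compm0.
- by move=> T h fh; apply: uk; rewrite -compmA fh compm0.
- by rewrite -compmA fk compm0.
- by move=> T h fh; apply: uk; apply: mm; rewrite compmA fh compm0.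
Qed.

End Exactness.

(** * Serre subcategories and morphisms with negligible kernel and cokernel *)

(** Serre subcategories, with short exact sequences taken relative to a
    preadditive structure. *)
Record serre_for (C : category) (P : preadditive C) (S : C -> Prop) : Prop :=
  SerreFor {
  sf_nonempty : exists X, S X;
  sf_sub : forall (X Y : C) (i : hom X Y), mono i -> S Y -> S X;
  sf_quo : forall (X Y : C) (p : hom X Y), epi p -> S X -> S Y;
  sf_ext : forall (X Y Z : C) (i : hom X Y) (p : hom Y Z),
    kernel P p i -> cokernel P i p -> S X -> S Z -> S Y
}.

Lemma serre_for_op (C : category) (P : preadditive C) (S : C -> Prop) :
  serre_for P S -> @serre_for (op C) (op_add P) S.
Proof.
case=> n s q e; split=> //= X Y; [exact: q|exact: s|].
by move=> Z i p ki ci SX SZ; apply: e ci ki SZ SX.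
Qed.

Lemma serreP (C : category) (P : preadditive C) (S : C -> Prop) :
  (exists Z : C, zero_object Z) -> serre S <-> serre_for P S.
Proof.
move=> hz; split=> -[n s q e]; split=> // X Y Z i p.
  move=> ki ci; apply: e (i) (p) _; split; first exact/(is_kernelP P hz).
  exact/(is_cokernelP P hz).
case=> /(is_kernelP P hz) ki /(is_cokernelP P hz) ci; exact: e ki ci.
Qed.

(** Morphisms with kernel, respectively cokernel, in [S]. *)
Definition smono (C : category) (P : preadditive C) (S : C -> Prop)
    (X Y : C) (f : hom X Y) :=
  exists (K : C) (k : hom K X), kernel P f k /\ S K.

Definition sepi (C : category) (P : preadditive C) (S : C -> Prop)
    (X Y : C) (f : hom X Y) :=
  exists (Q : C) (q : hom Y Q), cokernel P f q /\ S Q.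

Lemma serre_isoP (C : category) (P : preadditive C) (S : C -> Prop)
    (X Y : C) (f : hom X Y) :
  (exists Z : C, zero_object Z) ->
  serre_iso S f <-> smono P S f /\ sepi P S f.
Proof.
move=> hz; split=> -[[K [k [kk SK]]] [Q [q [cq SQ]]]]; split.
- by exists K, k; split=> //; apply/(is_kernelP P hz).
- by exists Q, q; split=> //; apply/(is_cokernelP P hz).
- by exists K, k; split=> //; apply/(is_kernelP P hz).
- by exists Q, q; split=> //; apply/(is_cokernelP P hz).
Qed.

Section SerreHalf.
Variables (C : category) (P : preadditive C) (S : C -> Prop).
Hypotheses (abP : abelian_for P) (sS : serre_for P S).
Implicit Types X Y Z T : C.
Local Notation "0" := (zerom P _ _) : cat_scope.

Lemma serre_iso_closed X Y : isomorphic X Y -> S X -> S Y.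
Proof.
by case/isomorphic_sym/mono_isomorphic=> f mf; apply: (sf_sub sS mf).
Qed.

Lemma mono_from_zero Z X (f : hom Z X) : idm Z = 0 -> mono f.
Proof. by move=> id0 T a b _; rewrite -[a]comp1m -[b]comp1m id0 !comp0m. Qed.

Lemma serre_zero Z : idm Z = 0 -> S Z.
Proof.
move=> id0; have [X SX] := sf_nonempty sS.
have m0 : mono (0 : hom Z X) by apply: mono_from_zero.
exact: (sf_sub sS m0 SX).
Qed.

(** [X] is an extension of the image of [f] by its kernel. *)
Lemma serre_source X Y (f : hom X Y) : smono P S f -> S Y -> S X.
Proof.
case=> K [k [kk SK]] SY; have [I [q [m [fE eq_ mm]]]] := epi_mono_factor abP f.
rewrite fE in kk; move/(kernel_monol _ _ _ mm): kk => kk.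
exact: (sf_ext sS kk (epi_cokernel_ker abP eq_ kk) SK (sf_sub sS mm SY)).
Qed.

Lemma kernel_smono X Y (f : hom X Y) K (k : hom K X) :
  kernel P f k -> smono P S f -> S K.
Proof.
move=> kk [L [l [kl SL]]]; have [u [v [_ vu uv]]] := kernel_uniq kl kk.
by apply: serre_iso_closed SL; exists u, v.
Qed.

Lemma mono_smono X Y (f : hom X Y) : mono f -> smono P S f.
Proof.
move=> mf; have [Z id0] := ab_zero abP.
exists Z, 0; split; last exact: serre_zero.
split=> [||T h fh]; [exact: compm0|exact: mono_from_zero|].
by exists 0; rewrite comp0m; apply: mf; rewrite fh compm0.
Qed.

Lemma smono_comp X Y Z (g : hom Y Z) (f : hom X Y) :
  smono P S g -> smono P S f -> smono P S (g \o f).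
Proof.
case=> K [k [[gk mk uk] SK]] [L [l [[fl ml ul] SL]]].
have [M [m [gfm mm um]]] := ab_ker abP (g \o f).
exists M, m; split=> //.
have [|u ku] := uk _ (f \o m); first by rewrite compmA.
have [|v mv] := um _ l; first by rewrite -compmA fl compm0.
(* [u] is the morphism induced by [f] from the kernel of [g \o f] to the kernel
   of [g]; the kernel of [u] is that of [f]. *)
apply: (@serre_source _ _ u _ SK).
exists L, v; split=> //; split.
- by apply: mk; rewrite compmA ku -compmA mv fl compm0.
- by apply: (@mono_compr _ _ _ _ m); rewrite mv.
move=> T h uh; have [|w lw] := ul _ (m \o h).
  by rewrite compmA -ku -compmA uh compm0.
by exists w; apply: mm; rewrite compmA mv.
Qed.

(** The cokernel of [k] is the coimage of [f], a subobject of [Y]. *)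
Lemma kernel_sepi X Y (f : hom X Y) K (k : hom K X) :
  kernel P f k -> S Y -> sepi P S k.
Proof.
move=> kk SY; have [Q [q cq]] := ab_coker abP k; exists Q, q; split=> //.
have [fk _ _] := kk; have [_ _ uq] := cq; have [m mq] := uq _ _ fk.
exact: (sf_sub sS (coimage_mono abP kk cq mq) SY).
Qed.

End SerreHalf.

Section SerreIso.
Variables (C : category) (P : preadditive C) (S : C -> Prop).
Hypotheses (abP : abelian_for P) (sS : serre_for P S).
Implicit Types X Y Z T : C.
Local Notation "0" := (zerom P _ _) : cat_scope.

(** The morphisms inverted in the Serre quotient, relative to a preadditive
    structure. *)
Definition siso X Y (f : hom X Y) := smono P S f /\ sepi P S f.

Let abO := abelian_for_op abP.
Let sO := serre_for_op sS.

Lemma serre_target X Y (f : hom X Y) : sepi P S f -> S X -> S Y.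
Proof. exact: (serre_source abO sO). Qed.

Lemma epi_sepi X Y (f : hom X Y) : epi f -> sepi P S f.
Proof. exact: (mono_smono abO sO). Qed.

Lemma siso_id X : siso (idm X).
Proof.
split; first by apply: mono_smono => // T a b; rewrite !comp1m.
by apply: epi_sepi => // T a b; rewrite !compm1.
Qed.

Lemma siso_comp X Y Z (g : hom Y Z) (f : hom X Y) :
  siso g -> siso f -> siso (g \o f).
Proof.
case=> mg eg [mf ef]; split; first exact: smono_comp.
exact: (smono_comp abO sO).
Qed.

Lemma kernel_siso X Y (f : hom X Y) K (k : hom K X) :
  kernel P f k -> S Y -> siso k.
Proof.
move=> kk SY; split; last exact: kernel_sepi kk SY.
by case: kk => _ mk _; apply: mono_smono.
Qed.

(** Here [f] factors through the kernel of [s], which lies in [S]; the kernel of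
    the factor does the job. *)
Lemma cancel_left X Y Z (s : hom Y Z) (f : hom X Y) : siso s -> s \o f = 0 ->
  exists T (t : hom T X), siso t /\ f \o t = 0.
Proof.
case=> -[K [k [[_ _ uk] SK]]] _ /uk[a <-].
have [T [t kt]] := ab_ker abP a; exists T, t.
split; first exact: kernel_siso kt SK.
by case: kt => at0 _ _; rewrite -compmA at0 compm0.
Qed.

(** The Ore condition.  Write [s] as a mono [m] after an epi [q].  The source
    of [f] may be shrunk to the preimage of the image of [s], the quotient by
    which embeds into the cokernel of [s]; there [f] factors through [m], and
    the pullback of [q] is an epi with the same kernel as [s]. *)
Lemma siso_ore X Y Z (f : hom X Y) (s : hom Z Y) : siso s ->
  exists T (s' : hom T X) (f' : hom T Z), siso s' /\ f \o s' = s \o f'.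
Proof.
case=> -[K [k [kk SK]]] [Q [c [cc SQ]]].
have [I [q [m [sE eq_ mm]]]] := epi_mono_factor abP s.
rewrite sE in kk cc; move/(kernel_monol _ _ _ mm): kk => kk.
have {}cc : cokernel P m c.
  exact/(@kernel_monol (op C) (op_add P) Y I Z q m Q c eq_).
have [_ _ um] := mono_kernel_coker abP mm cc.
have [J [j kj]] := ab_ker abP (c \o f); have [cfj _ _] := kj.
have [|g mg] := um _ (f \o j); first by rewrite compmA.
have [T [e [f' [ge ee ue]]]] := pullback_epi abP g eq_.
exists T, (j \o e), f'; split; last by rewrite compmA -mg -compmA ge sE compmA.
apply: siso_comp; first exact: kernel_siso kj SQ.
split; last exact: epi_sepi.
have [qk mk uk] := kk.
have [|l [[el fl] _]] := ue _ 0 k; first by rewrite compm0 qk.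
exists K, l; split=> //; split=> //.
  by apply: (@mono_compr _ _ _ _ f'); rewrite fl.
move=> U h eh; have [|w kw] := uk _ (f' \o h).
  by rewrite compmA -ge -compmA eh compm0.
have [|x [_ ux]] := ue U 0 (f' \o h).
  by rewrite compm0 compmA -ge -compmA eh compm0.
exists w; apply: etrans (esym (ux _ _)) (ux _ _) => //.
by rewrite !compmA el fl comp0m.
Qed.

End SerreIso.

(** The two sides differ only by the order of the kernel and cokernel
    conditions. *)
Lemma siso_op (C : category) (P : preadditive C) (S : C -> Prop) (X Y : C)
    (f : hom X Y) :
  @siso (op C) (op_add P) S Y X f <-> siso P S f.
Proof. by split=> -[? ?]. Qed.

Section SerreIsoDual.
Variables (C : category) (P : preadditive C) (S : C -> Prop).
Hypotheses (abP : abelian_for P) (sS : serre_for P S).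
Implicit Types X Y Z T : C.
Local Notation "0" := (zerom P _ _) : cat_scope.
Let abO := abelian_for_op abP.
Let sO := serre_for_op sS.

Lemma cancel_right X Y Z (s : hom X Y) (f : hom Y Z) :
  siso P S s -> f \o s = 0 ->
  exists T (t : hom Z T), siso P S t /\ t \o f = 0.
Proof.
move=> /siso_op Ws fs; have [T [t [Wt tf]]] := cancel_left abO sO Ws fs.
by exists T, t; split=> //; apply/siso_op.
Qed.

Lemma siso_ore_op X Y Z (f : hom Y X) (s : hom Y Z) : siso P S s ->
  exists T (s' : hom X T) (f' : hom Z T), siso P S s' /\ s' \o f = f' \o s.
Proof.
move=> /siso_op Ws; have [T [s' [f' [Ws' e]]]] := siso_ore abO sO f Ws.
by exists T, s', f'; split=> //; apply/siso_op.
Qed.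

End SerreIsoDual.

(** * The Gabriel-Zisman localization *)

Section LocalizationFunctor.
Variables (C : category) (W : forall X Y : C, hom X Y -> Prop).

Lemma loc_proj1 X : loc_proj W (idm X) = idm (X : localization W).
Proof. by apply/loc_classE; apply: zeq_id. Qed.

Lemma loc_projM X Y Z (g : hom Y Z) (f : hom X Y) :
  loc_proj W (g \o f) = loc_proj W g \o loc_proj W f.
Proof.
rewrite [RHS]loc_compE; apply/loc_classE; apply: zeq_sym; exact: zeq_comp.
Qed.

(** The formal inverse of an arrow of [W]. *)
Definition loc_inv X Y (w : hom X Y) (Ww : W w) : @hom (localization W) Y X :=
  loc_class (ZBwd Ww (ZNil W X)).

Lemma loc_proj_inv X Y (w : hom X Y) (Ww : W w) :
  loc_inv Ww \o loc_proj W w = idm (X : localization W) /\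
  loc_proj W w \o loc_inv Ww = idm (Y : localization W).
Proof.
split; rewrite [LHS]loc_compE; apply/loc_classE.
  exact: zeq_inv_r.
exact: zeq_inv_l.
Qed.

Lemma loc_isomorphic X Y (w : hom X Y) :
  W w -> @isomorphic (localization W) X Y.
Proof.
by move=> Ww; have [? ?] := loc_proj_inv Ww;
   exists (loc_proj W w), (loc_inv Ww).
Qed.

Variables (D : category) (G0 : C -> D).
Variable G1 : forall X Y, hom X Y -> hom (G0 X) (G0 Y).
Hypothesis G1_id : forall X, G1 (idm X) = idm (G0 X).
Hypothesis G1_comp : forall X Y Z (g : hom Y Z) (f : hom X Y),
  G1 (g \o f) = G1 g \o G1 f.
Hypothesis G1_inv : forall X Y (w : hom X Y), W w ->
  exists v, v \o G1 w = idm (G0 X) /\ G1 w \o v = idm (G0 Y).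

(** A chosen inverse of the image under [G1] of an arrow of [W]. *)
Definition loc_inverse X Y (w : hom X Y) (Ww : W w) : hom (G0 Y) (G0 X) :=
  sval (cid (G1_inv Ww)).

(** The value on zigzags of a functor inverting [W]. *)
Fixpoint zeval X Y (a : zigzag W X Y) : hom (G0 X) (G0 Y) :=
  match a with
  | ZNil X => idm (G0 X)
  | ZFwd _ _ _ f a' => zeval a' \o G1 f
  | ZBwd _ _ _ w Ww a' => zeval a' \o loc_inverse Ww
  end.

Lemma zeval_cat X Y (a : zigzag W X Y) Z (b : zigzag W Y Z) :
  zeval (zcat a b) = zeval b \o zeval a.
Proof.
elim: a Z b => [X'|X' Y' Z' f a IH|X' Y' Z' w Ww a IH] Z b /=.
- by rewrite compm1.
- by rewrite IH compmA.
- by rewrite IH compmA.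
Qed.

Lemma zeq_zeval X Y (a b : zigzag W X Y) : zeq a b -> zeval a = zeval b.
Proof.
elim=> //= {X Y a b}.
- by move=> X Y a b c _ -> _ ->.
- by move=> X Y Z f a b _ ->.
- by move=> X Y Z w Ww a b _ ->.
- by move=> X Y a; rewrite G1_id compm1.
- by move=> X Y Z T f g a; rewrite G1_comp compmA.
- move=> X Y Z w Ww a; rewrite /loc_inverse; case: cid => v [vw wv] /=.
  by rewrite -compmA vw compm1.
- move=> X Y Z w Ww a; rewrite /loc_inverse; case: cid => v [vw wv] /=.
  by rewrite -compmA wv compm1.
Qed.

(** A functor inverting [W] carries objects isomorphic in the localization to
    isomorphic objects. *)
Lemma isomorphic_localization X Y :
  @isomorphic (localization W) X Y -> isomorphic (G0 X) (G0 Y).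
Proof.
have zE (Z T : localization W) (f : hom Z T) (g : hom T Z) : g \o f = idm Z ->
    zeval (loc_rep g) \o zeval (loc_rep f) = idm (G0 Z).
  by move=> /loc_classE /zeq_zeval; rewrite zeval_cat.
by case=> f [g [/zE gf /zE fg]];
  exists (zeval (loc_rep f)), (zeval (loc_rep g)).
Qed.

End LocalizationFunctor.

(** ** Calculus of right fractions *)

Section Fractions.
Variables (C : category) (W : forall X Y : C, hom X Y -> Prop).
Hypothesis W_id : forall X, W (idm X).
Hypothesis W_comp : forall X Y Z (g : hom Y Z) (f : hom X Y),
  W g -> W f -> W (g \o f).
Hypothesis W_ore : forall X Y Z (f : hom X Y) (s : hom Z Y), W s ->
  exists T (s' : hom T X) (f' : hom T Z), W s' /\ f \o s' = s \o f'.

Local Notation Q := (loc_proj W).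

(** Every morphism of the localization is a right fraction. *)
Lemma right_fraction (X Y : C) (a : @hom (localization W) X Y) :
  exists (Z : C) (s : hom Z X) (f : hom Z Y), W s /\ a \o Q s = Q f.
Proof.
rewrite -(loc_repK a); elim: {a}(loc_rep a) => {X Y} [X|X Y Z f a|X Y Z w Ww a].
- exists X, (idm X), (idm X); split=> //.
  by rewrite loc_proj1; apply: compm1.
- move=> [T [s [g [Ws ag]]]]; have [U [s' [f' [Ws' e]]]] := W_ore f Ws.
  exists U, s', (g \o f'); split=> //.
  have -> : loc_class (ZFwd f a) =
      (loc_class a : @hom (localization W) Y Z) \o Q f.
    by rewrite [RHS]loc_compE.
  by rewrite -compmA -loc_projM e !loc_projM compmA ag.
move=> [T [s [g [Ws ag]]]]; exists T, (w \o s), g; split; first exact: W_comp.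
have -> : loc_class (ZBwd Ww a)
    = (loc_class a : @hom (localization W) Y Z) \o loc_inv Ww.
  by rewrite [RHS]loc_compE.
have [wK _] := loc_proj_inv Ww.
by rewrite loc_projM -compmA [_ \o (Q w \o _)]compmA wK comp1m.
Qed.

Hypothesis W_cancel : forall X Y Z (s : hom Y Z) (f g : hom X Y), W s ->
  s \o f = s \o g -> exists T (t : hom T X), W t /\ f \o t = g \o t.

(** Roofs [X <- Z -> Y] whose left leg lies in [W]. *)
Record roof (X Y : C) := Roof {
  roof_apex : C;
  roof_left : hom roof_apex X;
  roof_leftP : W roof_left;
  roof_right : hom roof_apex Y
}.

(** Two roofs are equivalent when they have a common refinement. *)
Definition roof_eq X Y (r r' : roof X Y) :=
  exists T (u : hom T (roof_apex r)) (v : hom T (roof_apex r')),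
    [/\ W (roof_left r \o u), roof_left r \o u = roof_left r' \o v
      & roof_right r \o u = roof_right r' \o v].

Lemma roof_eq_refl X Y (r : roof X Y) : roof_eq r r.
Proof.
exists (roof_apex r), (idm _), (idm _); split=> //; rewrite compm1.
exact: roof_leftP.
Qed.

Lemma roof_eq_sym X Y (r r' : roof X Y) : roof_eq r r' -> roof_eq r' r.
Proof. by case=> T [u [v [Wu e1 e2]]]; exists T, v, u; rewrite -e1. Qed.

Lemma roof_eq_trans X Y (r1 r2 r3 : roof X Y) :
  roof_eq r1 r2 -> roof_eq r2 r3 -> roof_eq r1 r3.
Proof.
case=> T [u [v [Wu e1 e2]]] [T' [u' [v' [Wu' e1' e2']]]].
rewrite e1 in Wu.
have [U [p [q [Wp e]]]] := W_ore (roof_left r2 \o v) Wu'.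
have [|V [w [Ww ew]]] := @W_cancel _ _ _ (roof_left r2) (v \o p) (u' \o q)
  (roof_leftP r2).
  by rewrite !compmA.
exists V, (u \o p \o w), (v' \o q \o w); split.
- rewrite !compmA e1; apply: W_comp => //; exact: W_comp.
- by rewrite !compmA e1 -e1' -!compmA [v \o _]compmA [u' \o _]compmA ew.
- by rewrite !compmA e2 -e2' -!compmA [v \o _]compmA [u' \o _]compmA ew.
Qed.

(** Composition of the right leg with a morphism. *)
Definition roof_push X Y Z (g : hom Y Z) (r : roof X Y) : roof X Z :=
  Roof (roof_leftP r) (g \o roof_right r).

Lemma roof_push_eq X Y Z (g : hom Y Z) (r r' : roof X Y) :
  roof_eq r r' -> roof_eq (roof_push g r) (roof_push g r').
Proof.
case=> T [u [v [Wu e1 e2]]]; exists T, u, v; split=> //=.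
by rewrite -!compmA e2.
Qed.

Lemma roof_push1 X Y (r : roof X Y) : roof_push (idm Y) r = r.
Proof. by case: r => T s Ws f; rewrite /roof_push /= comp1m. Qed.

Lemma roof_pushM X Y Z T (h : hom Z T) (g : hom Y Z) (r : roof X Y) :
  roof_push h (roof_push g r) = roof_push (h \o g) r.
Proof. by rewrite /roof_push /= compmA. Qed.

(** Post-composition with an arrow of [W] is bijective on classes of roofs. *)
Lemma roof_push_inj X Y Z (w : hom Y Z) (r r' : roof X Y) : W w ->
  roof_eq (roof_push w r) (roof_push w r') -> roof_eq r r'.
Proof.
move=> Ww [T [u [v [/= Wu e1 e2]]]].
have [|U [t [Wt e]]] := @W_cancel _ _ _ w (roof_right r \o u)
  (roof_right r' \o v) Ww.
  by rewrite !compmA.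
exists U, (u \o t), (v \o t); rewrite !compmA; split=> //; first exact: W_comp.
by rewrite e1.
Qed.

Lemma roof_push_surj X Y Z (w : hom Y Z) (r : roof X Z) : W w ->
  exists r' : roof X Y, roof_eq (roof_push w r') r.
Proof.
move=> Ww; have [T [s [f [Ws e]]]] := W_ore (roof_right r) Ww.
exists (Roof (W_comp (roof_leftP r) Ws) f), T, (idm T), s => /=.
by rewrite !compm1; split=> //; apply: W_comp => //; apply: roof_leftP.
Qed.

(** Zigzags act on classes of roofs out of [X]: forward arrows by [roof_push],
    backward ones by its inverse.  The action is given by its graph. *)
Fixpoint roof_act X Y Z (a : zigzag W Y Z) : roof X Y -> roof X Z -> Prop :=
  match a with
  | ZNil _ => fun r r' => roof_eq r r'
  | ZFwd _ _ _ f a' => fun r r' => roof_act a' (roof_push f r) r'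
  | ZBwd _ _ _ w _ a' => fun r r' =>
      exists2 r'', roof_eq (roof_push w r'') r & roof_act a' r'' r'
  end.

Lemma roof_act_eq X Y Z (a : zigzag W Y Z) (r1 r2 : roof X Y) r' :
  roof_eq r1 r2 -> roof_act a r1 r' -> roof_act a r2 r'.
Proof.
elim: a r1 r2 r' => {Y Z} [Y|Y Z T f a IH|Y Z T w Ww a IH] r1 r2 r' e /=.
- exact: roof_eq_trans (roof_eq_sym e).
- exact: IH (roof_push_eq f e).
- by case=> r'' e' ar; exists r'' => //; apply: roof_eq_trans e.
Qed.

Lemma zeq_roof_act X Y Z (a b : zigzag W Y Z) (r : roof X Y) r' :
  zeq a b -> roof_act a r r' <-> roof_act b r r'.
Proof.
move=> e; elim: e r r' => {Y Z a b} /=.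
- by [].
- by move=> Y Z a b _ IH r r'; split=> /IH.
- move=> Y Z a b c _ IH1 _ IH2 r r'.
  by split=> [/IH1/IH2|/IH2/IH1].
- by move=> *; auto.
- by move=> Y Z T w Ww a b _ IH r r'; split=> -[r'' e /IH]; exists r''.
- by move=> Y Z a r r'; rewrite roof_push1.
- by move=> Y Z T U f g a r r'; rewrite roof_pushM.
- move=> Y Z T w Ww a r r'; split=> [[r'' /(roof_push_inj Ww) e]|ar].
    exact: roof_act_eq.
  by exists r => //; apply: roof_eq_refl.
- move=> Y Z T w Ww a r r'; split=> [[r'' e]|ar]; first exact: roof_act_eq.
  have [r'' e] := roof_push_surj r Ww; exists r'' => //.
  exact: roof_act_eq (roof_eq_sym e) ar.
Qed.

(** Morphisms of [C] identified in the localization agree after precomposition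
    with an arrow of [W]: compare their actions on the identity roof. *)
Lemma loc_proj_eq X Y (f g : hom X Y) : Q f = Q g ->
  exists T (t : hom T X), W t /\ f \o t = g \o t.
Proof.
move=> /loc_classE /zeq_roof_act act.
pose r := Roof (W_id X) (idm X).
have [_ /(_ (roof_eq_refl _))] := act X r (roof_push g r).
case=> T [u [v [/= Wu e1 e2]]]; exists T, u.
by move: Wu e1 e2; rewrite !comp1m !compm1 => Wu <-.
Qed.

End Fractions.

(** ** Calculus of fractions on both sides *)

(** [fractions W F] holds when the functor [F] is surjective on objects, inverts
    [W], and has left and right calculi of fractions: morphisms of its target
    are fractions on either side, and morphisms with the same image are
    equalized and coequalized by arrows of [W].  The notion is self-dual. *)
Record fractions (C D : category) (W : forall X Y : C, hom X Y -> Prop)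
    (F0 : C -> D) (F : forall X Y, hom X Y -> hom (F0 X) (F0 Y)) : Prop :=
  IsFractions {
  fr_surj : forall X : D, exists X', F0 X' = X;
  fr_id : forall X, F _ _ (idm X) = idm (F0 X);
  fr_comp : forall X Y Z (g : hom Y Z) (f : hom X Y),
    F _ _ (g \o f) = F _ _ g \o F _ _ f;
  fr_inv : forall X Y (w : hom X Y), W _ _ w ->
    exists v, v \o F _ _ w = idm (F0 X) /\ F _ _ w \o v = idm (F0 Y);
  fr_right : forall X Y (a : hom (F0 X) (F0 Y)),
    exists Z (s : hom Z X) (f : hom Z Y), W _ _ s /\ a \o F _ _ s = F _ _ f;
  fr_left : forall X Y (a : hom (F0 X) (F0 Y)),
    exists Z (s : hom Y Z) (f : hom X Z), W _ _ s /\ F _ _ s \o a = F _ _ f;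
  fr_eq_right : forall X Y (f g : hom X Y), F _ _ f = F _ _ g ->
    exists Z (s : hom Z X), W _ _ s /\ f \o s = g \o s;
  fr_eq_left : forall X Y (f g : hom X Y), F _ _ f = F _ _ g ->
    exists Z (s : hom Y Z), W _ _ s /\ s \o f = s \o g
}.

Lemma fractions_op (C D : category) (W : forall X Y : C, hom X Y -> Prop)
    (F0 : C -> D) (F : forall X Y, hom X Y -> hom (F0 X) (F0 Y)) :
  fractions W F ->
  @fractions (op C) (op D) (fun X Y f => W Y X f) F0 (fun X Y f => F Y X f).
Proof.
case=> hs h1 hM hi hr hl er el; split=> //=.
- by move=> X Y w /hi[v [? ?]]; exists v.
- by move=> X Y f g; apply: el.
- by move=> X Y f g; apply: er.
Qed.

Section LocalizationFractions.
Variables (C : category) (P : preadditive C) (S : C -> Prop).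
Hypotheses (abP : abelian_for P) (sS : serre_for P S).

(** As predicates are extensional, the Serre quotient is literally the
    localization at [siso P S]. *)
Lemma serre_iso_siso : @serre_iso C S = siso P S.
Proof.
do 3![apply: functional_extensionality_dep => ?]; apply: propext.
exact: serre_isoP (abelian_for_zero abP).
Qed.

Lemma siso_cancel X Y Z (s : hom Y Z) (f g : hom X Y) :
  siso P S s -> s \o f = s \o g ->
  exists T (t : hom T X), siso P S t /\ f \o t = g \o t.
Proof.
move=> Ws e.
have [|T [t [Wt e0]]] := cancel_left abP sS (f := addm P f (oppm P g)) Ws.
  by rewrite compmD compmN e addmN.
exists T, t; split=> //; apply: (@subm_eq0 _ P).
by rewrite -compNm -compDm.
Qed.

Lemma siso_cancel_op X Y Z (s : hom X Y) (f g : hom Y Z) :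
  siso P S s -> f \o s = g \o s ->
  exists T (t : hom Z T), siso P S t /\ t \o f = t \o g.
Proof.
move=> Ws e.
have [|T [t [Wt e0]]] := cancel_right abP sS (f := addm P f (oppm P g)) Ws.
  by rewrite compDm compNm e addmN.
exists T, t; split=> //; apply: (@subm_eq0 _ P).
by rewrite -compmN -compmD.
Qed.

(** The projection to the Serre quotient has both calculi of fractions; the left
    one follows from the right one and the dual Ore condition. *)
Lemma siso_fractions :
  fractions (siso P S) (F0 := fun X : C => X : serre_quotient S)
    (fun X Y f => loc_proj (@serre_iso C S) f).
Proof.
rewrite /serre_quotient serre_iso_siso.
have Wid := siso_id abP sS; have Wcomp := @siso_comp _ _ _ abP sS.
have Wore := @siso_ore _ _ _ abP sS; have Wcan := siso_cancel.
have inv := loc_proj_inv (W := siso P S).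
split.
- by move=> X; exists X.
- exact: loc_proj1.
- exact: loc_projM.
- by move=> X Y w Ww; exists (loc_inv Ww); apply: inv.
- by move=> X Y a; apply: right_fraction.
- move=> X Y a.
  have [Z [s [f [Ws af]]]] := right_fraction Wid Wcomp Wore a.
  have [T [s' [f' [Ws' e]]]] := siso_ore_op abP sS f Ws.
  exists T, s', f'; split=> //.
  move/(congr1 (@loc_proj _ (siso P S) _ _)): e; rewrite !loc_projM -af compmA.
  have [_ sK] := inv _ _ _ Ws.
  move/(congr1 (fun g => g \o loc_inv Ws)).
  by rewrite -!compmA sK !compm1.
- by move=> X Y f g; apply: loc_proj_eq.
- move=> X Y f g /(loc_proj_eq Wid Wcomp Wore Wcan)[T [t [Wt e]]].
  exact: siso_cancel_op Wt e.
Qed.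

End LocalizationFractions.

(** * The additive structure of a localization *)

Section LocalizationAdd.
Variables (C : category) (P : preadditive C).
Variable W : forall X Y : C, hom X Y -> Prop.
Hypothesis W_id : forall X, W (idm X).
Hypothesis W_comp : forall X Y Z (g : hom Y Z) (f : hom X Y),
  W g -> W f -> W (g \o f).
Hypothesis W_ore : forall X Y Z (f : hom X Y) (s : hom Z Y), W s ->
  exists T (s' : hom T X) (f' : hom T Z), W s' /\ f \o s' = s \o f'.

Local Notation L := (localization W).
Local Notation Q := (loc_proj W).
Hypothesis fr : fractions W (F0 := fun X : C => X : L) (fun X Y f => Q f).

Implicit Types X Y Z T : L.

Lemma loc_epi (X : C) Y (Z : C) (s : hom Z X) (a b : @hom L X Y) :
  W s -> a \o Q s = b \o Q s -> a = b.
Proof.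
move=> /(fr_inv fr)[v [_ sv]] /(congr1 (fun g => g \o v)).
by rewrite -!compmA sv !compm1.
Qed.

Lemma common_denominator (X Y Z : C) (a : @hom L X Y) (b : @hom L X Z) :
  exists (T : C) (s : hom T X) (f : hom T Y) (g : hom T Z),
    [/\ W s, a \o Q s = Q f & b \o Q s = Q g].
Proof.
have [T [s [f [Ws af]]]] := fr_right fr a.
have [U [t [g [Wt bg]]]] := fr_right fr b.
have [V [s' [t' [Ws' e]]]] := W_ore s Wt.
exists V, (s \o s'), (f \o s'), (g \o t'); split; first exact: W_comp.
  by rewrite !loc_projM compmA af.
by rewrite e !loc_projM compmA bg.
Qed.

Lemma common_denominator3 (X Y Z T : C) (a : @hom L X Y) (b : @hom L X Z)
    (c : @hom L X T) :
  exists (U : C) (s : hom U X) (f : hom U Y) (g : hom U Z) (h : hom U T),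
    [/\ W s, a \o Q s = Q f, b \o Q s = Q g & c \o Q s = Q h].
Proof.
have [U [s [f [g [Ws af bg]]]]] := common_denominator a b.
have [V [t [h [k [Wt sh ck]]]]] := common_denominator (Q (idm X)) c.
have [V' [s' [t' [Ws' e]]]] := W_ore s Wt.
exists V', (s \o s'), (f \o s'), (g \o s'), (k \o t').
split; first exact: W_comp; try by rewrite !loc_projM compmA (af, bg).
by rewrite e !loc_projM compmA ck.
Qed.

(** [c] is the sum of [a] and [b], computed over some common denominator. *)
Definition is_sum (X Y : C) (a b c : @hom L X Y) :=
  exists (T : C) (s : hom T X) (f g : hom T Y),
    [/\ W s, a \o Q s = Q f, b \o Q s = Q g & c \o Q s = Q (addm P f g)].

Lemma is_sum_ex (X Y : C) (a b : @hom L X Y) : exists c, is_sum a b c.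
Proof.
have [T [s [f [g [Ws af bg]]]]] := common_denominator a b.
have [v [vs _]] := fr_inv fr Ws.
by exists (Q (addm P f g) \o v), T, s, f, g; rewrite -compmA vs compm1.
Qed.

Lemma is_sum_uniq (X Y : C) (a b c c' : @hom L X Y) :
  is_sum a b c -> is_sum a b c' -> c = c'.
Proof.
case=> T [s [f [g [Ws af bg cfg]]]] [T' [s' [f' [g' [Ws' af' bg' cfg']]]]].
have [U [t [u [Wt e]]]] := W_ore s Ws'.
have fu : Q (f \o t) = Q (f' \o u).
  by rewrite !loc_projM -af -af' -!compmA -!loc_projM e.
have gu : Q (g \o t) = Q (g' \o u).
  by rewrite !loc_projM -bg -bg' -!compmA -!loc_projM e.
have [V [v [Wv ev]]] := fr_eq_right fr fu.
have [|V' [v' [Wv' ev']]] := @fr_eq_right _ _ _ _ _ fr _ _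
    (g \o t \o v) (g' \o u \o v).
  by rewrite [LHS]loc_projM gu -loc_projM.
apply: (@loc_epi _ _ V' (s \o (t \o (v \o v')))).
  by do 3![apply: W_comp => //].
(* Over [V'] both denominators and all four numerators agree. *)
have E : s \o (t \o (v \o v')) = s' \o (u \o (v \o v')) by rewrite !compmA e.
rewrite {2}E !(loc_projM _ s) !(loc_projM _ s') !compmA cfg cfg' -!loc_projM.
by rewrite !compDm !compmA ev ev'.
Qed.

(** The sum of two morphisms of the localization. *)
Definition loc_add (X Y : C) (a b : @hom L X Y) : @hom L X Y :=
  sval (cid (is_sum_ex a b)).

Lemma loc_addE (X Y T : C) (s : hom T X) (f g : hom T Y) (a b : @hom L X Y) :
  W s -> a \o Q s = Q f -> b \o Q s = Q g ->
  loc_add a b \o Q s = Q (addm P f g).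
Proof.
move=> Ws af bg; have [v [vs _]] := fr_inv fr Ws.
have -> : loc_add a b = Q (addm P f g) \o v; last by rewrite -compmA vs compm1.
apply: is_sum_uniq (svalP (cid (is_sum_ex a b))) _.
by exists T, s, f, g; rewrite -compmA vs compm1.
Qed.

Lemma loc_projD (X Y : C) (f g : hom X Y) :
  Q (addm P f g) = loc_add (Q f) (Q g).
Proof.
apply: (loc_epi (W_id X)); rewrite (@loc_addE _ _ _ (idm X) f g) ?W_id //;
by rewrite -loc_projM compm1.
Qed.

Lemma loc_opp_ex (X Y : C) (a : @hom L X Y) :
  exists b, loc_add b a = Q (zerom P X Y).
Proof.
have [T [s [f [Ws af]]]] := fr_right fr a.
have [v [vs _]] := fr_inv fr Ws.
exists (Q (oppm P f) \o v); apply: (loc_epi Ws).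
rewrite (@loc_addE _ _ _ s (oppm P f) f) //; last by rewrite -compmA vs compm1.
by rewrite addNm -loc_projM comp0m.
Qed.

Lemma loc_addA (X Y : C) : associative (@loc_add X Y).
Proof.
move=> a b c.
have [T [s [f [g [h [Ws af bg ch]]]]]] := common_denominator3 a b c.
apply: (loc_epi Ws).
rewrite (loc_addE Ws af (loc_addE Ws bg ch)).
by rewrite (loc_addE Ws (loc_addE Ws af bg) ch) addmA.
Qed.

Lemma loc_addC (X Y : C) : commutative (@loc_add X Y).
Proof.
move=> a b; have [T [s [f [g [Ws af bg]]]]] := common_denominator a b.
by apply: (loc_epi Ws); rewrite (loc_addE Ws af bg) (loc_addE Ws bg af) addmC.
Qed.

Lemma loc_add0 (X Y : C) : left_id (Q (zerom P X Y)) (@loc_add X Y).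
Proof.
move=> a; have [T [s [f [Ws af]]]] := fr_right fr a.
have z : Q (zerom P X Y) \o Q s = Q (zerom P T Y) by rewrite -loc_projM comp0m.
by apply: (loc_epi Ws); rewrite (loc_addE Ws z af) add0m af.
Qed.

Lemma loc_compDm (X Y Z : C) (g g' : @hom L Y Z) (f : @hom L X Y) :
  loc_add g g' \o f = loc_add (g \o f) (g' \o f).
Proof.
have [T [s [h [h' [Ws gh gh']]]]] := common_denominator g g'.
have [U [t [k [Wt fk]]]] := fr_right fr f.
have [V [s' [k' [Ws' e]]]] := W_ore k Ws.
have Wts : W (t \o s') by apply: W_comp.
have fE : f \o Q (t \o s') = Q s \o Q k'.
  by rewrite loc_projM compmA fk -loc_projM e loc_projM.
apply: (loc_epi Wts); rewrite (@loc_addE _ _ _ _ (h \o k') (h' \o k')) //.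
- by rewrite -compmA fE compmA (loc_addE Ws gh gh') -loc_projM compDm.
- by rewrite -compmA fE compmA gh loc_projM.
- by rewrite -compmA fE compmA gh' loc_projM.
Qed.

Lemma loc_compmD (X Y Z : C) (g : @hom L Y Z) (f f' : @hom L X Y) :
  g \o loc_add f f' = loc_add (g \o f) (g \o f').
Proof.
have [T [s [h [h' [Ws fh fh']]]]] := common_denominator f f'.
have [U [t [k [Wt gk]]]] := fr_right fr g.
have [V [t1 [k1 [Wt1 e1]]]] := W_ore h Wt.
have [V' [t2 [k2 [Wt2 e2]]]] := W_ore (h' \o t1) Wt.
have Ws' : W (s \o (t1 \o t2)) by do 2![apply: W_comp => //].
have fE : f \o Q (s \o (t1 \o t2)) = Q (t \o (k1 \o t2)).
  by rewrite loc_projM compmA fh -loc_projM compmA e1 -compmA.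
have fE' : f' \o Q (s \o (t1 \o t2)) = Q (t \o k2).
  by rewrite loc_projM compmA fh' -loc_projM compmA e2.
apply: (loc_epi Ws').
rewrite (@loc_addE _ _ _ _ (k \o (k1 \o t2)) (k \o k2)) //.
- by rewrite -compmA (loc_addE Ws' fE fE') -!compmD !loc_projM compmA gk.
- by rewrite -compmA fE loc_projM compmA gk -loc_projM.
- by rewrite -compmA fE' loc_projM compmA gk -loc_projM.
Qed.

(** The additive structure for which the projection is additive. *)
Definition loc_preadditive : preadditive L :=
  @Preadditive L (fun X Y => Q (zerom P X Y))
    (fun X Y a => sval (cid (loc_opp_ex a))) loc_add loc_addA loc_addC loc_add0
    (fun X Y a => svalP (cid (loc_opp_ex a))) loc_compDm loc_compmD.

End LocalizationAdd.

(** * The Serre quotient is abelian *)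

Lemma kernel_iso_pre (A : category) (M : preadditive A) (X Y Z K : A)
    (a : hom X Y) (s : hom Z X) (v : hom X Z) (k : hom K Z) :
  v \o s = idm Z -> s \o v = idm X ->
  kernel M (a \o s) k -> kernel M a (s \o k).
Proof.
move=> vs sv [ak mk uk]; split; first by rewrite compmA.
  exact: mono_comp (mono_retract vs) mk.
move=> T h ah; have [|u ku] := uk T (v \o h).
  by rewrite -compmA [s \o _]compmA sv comp1m.
by exists u; rewrite -compmA ku compmA sv comp1m.
Qed.

(** The class [W] is kept apart from [siso P S], to which it is only required to
    be equivalent, so that the results apply in the opposite categories, where
    the kernel and cokernel conditions are exchanged. *)
Section QuotientHalf.
Variables (C D : category) (P : preadditive C) (R : preadditive D).
Variables (S : C -> Prop) (W : forall X Y : C, hom X Y -> Prop).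
Variables (F0 : C -> D) (F : forall X Y : C, hom X Y -> hom (F0 X) (F0 Y)).
Hypotheses (abP : abelian_for P) (sS : serre_for P S).
Hypothesis WP : forall X Y (f : hom X Y), W f <-> siso P S f.
Hypothesis fr : fractions W F.
Hypothesis F_add : forall X Y (f g : hom X Y),
  F (addm P f g) = addm R (F f) (F g).

Lemma functor0 X Y : F (zerom P X Y) = zerom R _ _.
Proof.
by apply: (@addmI _ R _ _ (F (zerom P X Y))); rewrite -F_add !addm0.
Qed.

Lemma functor_eq0 X Y (f : hom X Y) : F f = zerom R _ _ ->
  exists Z (s : hom Z X), W s /\ f \o s = zerom P _ _.
Proof.
rewrite -functor0 => /(fr_eq_right fr)[Z [s [Ws e]]].
by exists Z, s; rewrite e comp0m.
Qed.

(** If the identity vanishes in the quotient, it vanishes on some [s] with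
    cokernel in [S], so [X] embeds into that cokernel. *)
Lemma functor_zero_obj X : idm (F0 X) = zerom R _ _ -> S X.
Proof.
rewrite -(fr_id fr) => /functor_eq0[Z [s [/WP[_ [Q [q [[_ _ uq] SQ]]]]]]].
move/uq=> [u uq1]; exact: (sf_sub sS (mono_retract uq1)).
Qed.

Lemma functor_obj0 X : S X -> idm (F0 X) = zerom R _ _.
Proof.
move=> SX; have [Z id0] := ab_zero abP.
have : W (zerom P Z X).
  apply/WP; split; first by apply: mono_smono => //; apply: mono_from_zero id0.
  exists X, (idm X); split=> //; split; first exact: compm0.
    by move=> T a b; rewrite !compm1.
  by move=> T h _; exists h; rewrite compm1.
move/(fr_inv fr)=> [v [_ <-]]; by rewrite functor0 comp0m.
Qed.

Lemma functor_mono X Y (f : hom X Y) : mono f -> mono (F f).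
Proof.
move=> mf; apply/(monoP R) => T; have [T' <-] := fr_surj fr T => h.
have [Z [s [g [Ws hs]]]] := fr_right fr h; have [v [_ sv]] := fr_inv fr Ws.
move=> fh; have : F (f \o g) = zerom R _ _.
  by rewrite (fr_comp fr) -hs compmA fh comp0m.
case/functor_eq0=> U [t [Wt]]; rewrite -compmA => e.
have gt : g \o t = zerom P _ _ by apply: mf; rewrite e compm0.
have [w [_ tw]] := fr_inv fr Wt.
rewrite -[h]compm1 -sv compmA hs -[F g]compm1 -tw [F g \o _]compmA.
by rewrite -(fr_comp fr) gt functor0 !comp0m.
Qed.

Lemma functor_kernel X Y (f : hom X Y) K (k : hom K X) :
  kernel P f k -> kernel R (F f) (F k).
Proof.
move=> [fk mk uk]; split; first by rewrite -(fr_comp fr) fk functor0.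
  exact: functor_mono.
move=> T; have [T' <-] := fr_surj fr T => h.
have [Z [s [g [Ws hs]]]] := fr_right fr h; have [v [_ sv]] := fr_inv fr Ws.
move=> fh; have : F (f \o g) = zerom R _ _.
  by rewrite (fr_comp fr) -hs compmA fh comp0m.
case/functor_eq0=> U [t [Wt]]; rewrite -compmA => /uk[u ku].
have [w [_ tw]] := fr_inv fr Wt; exists (F u \o w \o v).
rewrite !compmA -(fr_comp fr) ku (fr_comp fr) -(compmA (F g)) tw compm1.
by rewrite -hs -compmA sv compm1.
Qed.

Lemma functor_mono_smono X Y (f : hom X Y) : mono (F f) -> smono P S f.
Proof.
move=> mf; have [K [k kk]] := ab_ker abP f; exists K, k; split=> //.
apply: functor_zero_obj; have [fk mk _] := kk.
apply: (functor_mono mk); apply: mf.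
by rewrite !compm0 compm1 -(fr_comp fr) fk functor0.
Qed.

Lemma quotient_ker (X Y : D) (a : hom X Y) :
  exists K (k : hom K X), kernel R a k.
Proof.
have [X' eX] := fr_surj fr X; have [Y' eY] := fr_surj fr Y.
case: X / eX a => a; case: Y / eY a => a.
have [Z [s [f [Ws af]]]] := fr_right fr a; have [v [vs sv]] := fr_inv fr Ws.
have [K [k /functor_kernel kk]] := ab_ker abP f.
by exists (F0 K), (F s \o F k); apply: kernel_iso_pre vs sv _; rewrite af.
Qed.

(** Up to isomorphism, a mono of the quotient comes from a morphism of [C] with
    kernel in [S], which is a mono [m] after a morphism of [W]; so it comes from
    [m], which is a kernel in [C]. *)
Lemma quotient_mono (X Y : D) (a : hom X Y) : mono a ->
  exists Z (g : hom Y Z), kernel R g a.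
Proof.
have [X' eX] := fr_surj fr X; have [Y' eY] := fr_surj fr Y.
case: X / eX a => a; case: Y / eY a => a ma.
have [Z [s [f [Ws af]]]] := fr_right fr a; have [v [vs sv]] := fr_inv fr Ws.
have mf : mono (F f) by rewrite -af; apply: mono_comp (mono_retract vs).
have [I [q [m [fE eq_ mm]]]] := epi_mono_factor abP f.
have Wq : W q.
  apply/WP; split; last exact: epi_sepi.
  apply: functor_mono_smono; apply: (@mono_compr _ _ _ _ (F m)).
  by rewrite -(fr_comp fr) -fE.
have [v' [vq qv]] := fr_inv fr Wq.
have [Q [c cc]] := ab_coker abP m.
have aE : a = F m \o (F q \o v).
  by rewrite compmA -(fr_comp fr) -fE -af -compmA sv compm1.
exists (F0 Q), (F c); rewrite aE.
have km := functor_kernel (mono_kernel_coker abP mm cc).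
apply: (kernel_iso (v := F s \o v') km).
  by rewrite -compmA [v' \o _]compmA vq comp1m.
by rewrite -compmA [v \o _]compmA vs comp1m.
Qed.

End QuotientHalf.

Section Quotient.
Variables (C D : category) (P : preadditive C) (R : preadditive D).
Variables (S : C -> Prop).
Variables (F0 : C -> D) (F : forall X Y : C, hom X Y -> hom (F0 X) (F0 Y)).
Hypotheses (abP : abelian_for P) (sS : serre_for P S).
Hypothesis fr : fractions (siso P S) F.
Hypothesis F_add : forall X Y (f g : hom X Y),
  F (addm P f g) = addm R (F f) (F g).

Let WP X Y (f : hom X Y) : siso P S f <-> siso P S f.
Proof. by []. Qed.
Let WPo (X Y : op C) (f : @hom (op C) X Y) :
  @siso C P S Y X f <-> @siso (op C) (op_add P) S X Y f.
Proof. by split=> -[]. Qed.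

Lemma functor_cokernel X Y (f : hom X Y) Q (q : hom Y Q) :
  cokernel P f q -> cokernel R (F f) (F q).
Proof.
exact: (@functor_kernel (op C) (op D) (op_add P) (op_add R)
  (fun X Y f => siso P S f) F0 (fun X Y f => F f) (fractions_op fr)
  (fun X Y f g => F_add f g) Y X f Q q).
Qed.

Lemma functor_epi_sepi X Y (f : hom X Y) : epi (F f) -> sepi P S f.
Proof.
exact: (@functor_mono_smono (op C) (op D) (op_add P) (op_add R) S
  (fun X Y f => siso P S f) F0 (fun X Y f => F f) (abelian_for_op abP)
  (serre_for_op sS) WPo (fractions_op fr) (fun X Y f g => F_add f g) Y X f).
Qed.

Lemma functor_siso X Y (f : hom X Y) : mono (F f) -> epi (F f) -> siso P S f.
Proof.
move=> mf ef; split; first exact: (functor_mono_smono abP sS WP fr F_add mf).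
exact: functor_epi_sepi.
Qed.

Lemma quotient_abelian : abelian_for R.
Proof.
have F0m := functor0 F_add.
split.
- have [Z id0] := ab_zero abP; exists (F0 Z).
  by rewrite -(fr_id fr) id0 F0m.
- move=> X Y; have [X' <-] := fr_surj fr X; have [Y' <-] := fr_surj fr Y.
  have [B [i1 [i2 [p1 [p2 [h1 h2 h3 h4 h5]]]]]] := ab_biprod abP X' Y'.
  exists (F0 B), (F i1), (F i2), (F p1), (F p2).
  by rewrite -!(fr_comp fr) -F_add h1 h2 h3 h4 h5 !F0m !(fr_id fr).
- exact: (quotient_ker abP fr F_add).
- move=> X Y f.
  exact: (@quotient_ker (op C) (op D) (op_add P) (op_add R)
    (fun X Y f => siso P S f) F0 (fun X Y f => F f) (abelian_for_op abP)
    (fractions_op fr) (fun X Y f g => F_add f g) Y X f).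
- exact: (quotient_mono abP sS WP fr F_add).
- move=> X Y f.
  exact: (@quotient_mono (op C) (op D) (op_add P) (op_add R) S
    (fun X Y f => siso P S f) F0 (fun X Y f => F f) (abelian_for_op abP)
    (serre_for_op sS) WPo (fractions_op fr) (fun X Y f g => F_add f g) Y X f).
Qed.

End Quotient.

Section SerreQuotient.
Variables (C : category) (P : preadditive C) (S : C -> Prop).
Hypotheses (abP : abelian_for P) (sS : serre_for P S).

Local Notation Q := (loc_proj (@serre_iso C S)).

Lemma serre_quotient_preadditive : exists R : preadditive (serre_quotient S),
  forall X Y (f g : hom X Y), Q (addm P f g) = addm R (Q f) (Q g).
Proof.
have Wid := siso_id abP sS; have Wcomp := @siso_comp _ _ _ abP sS.
have Wore := @siso_ore _ _ _ abP sS; have fr := siso_fractions abP sS.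
rewrite /serre_quotient in fr *; rewrite (serre_iso_siso S abP) in fr *.
by exists (loc_preadditive P Wcomp Wore fr) => X Y f g; apply: loc_projD.
Qed.

Lemma siso_isomorphic X Y (f : hom X Y) :
  siso P S f -> @isomorphic (serre_quotient S) X Y.
Proof. by rewrite -(serre_iso_siso S abP) => /loc_isomorphic. Qed.

(** Isomorphism in the quotient is witnessed by a span. *)
Lemma isomorphic_span (X Y : C) : @isomorphic (serre_quotient S) X Y ->
  exists Z (s : hom Z X) (t : hom Z Y), siso P S s /\ siso P S t.
Proof.
have fr := siso_fractions abP sS; have [R F_add] := serre_quotient_preadditive.
case=> a [b [ba ab]]; have [Z [s [f [Ws af]]]] := fr_right fr a.
have [v [vs sv]] := fr_inv fr Ws; exists Z, s, f; split=> //.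
apply: (functor_siso abP sS fr F_add); rewrite -af.
  by apply: mono_comp (mono_retract vs); apply: mono_retract ba.
move=> T g h; rewrite !compmA => /(congr1 (fun k => k \o (v \o b))).
by rewrite -!compmA ![_ \o (v \o b)]compmA sv comp1m ab !compm1.
Qed.

End SerreQuotient.

Lemma saturation_incl (A : category) (S K : A -> Prop) X :
  K X -> saturation S K X.
Proof.
move=> KX; exists X; split=> //; exists (idm (X : serre_quotient S)), (idm _).
by rewrite comp1m.
Qed.

(** * Preimages of Serre subcategories under exact functors *)

Section ExactFunctor.
Variables (C D : category) (P : preadditive C) (R : preadditive D).
Variables (G0 : C -> D) (G : forall X Y : C, hom X Y -> hom (G0 X) (G0 Y)).
Hypotheses (abP : abelian_for P) (abR : abelian_for R).
Hypothesis G_id : forall X, G (idm X) = idm (G0 X).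
Hypothesis G_comp : forall X Y Z (g : hom Y Z) (f : hom X Y),
  G (g \o f) = G g \o G f.
Hypothesis G_ker : forall X Y (f : hom X Y) K (k : hom K X),
  kernel P f k -> kernel R (G f) (G k).
Hypothesis G_coker : forall X Y (f : hom X Y) Q (q : hom Y Q),
  cokernel P f q -> cokernel R (G f) (G q).
Variable T : D -> Prop.

Lemma exact_serre : serre_for R T -> (exists X, T (G0 X)) ->
  serre_for P (fun X => T (G0 X)).
Proof.
case=> _ s q e hT; split=> //.
- move=> X Y i /(ab_mono abP)[Z [g /G_ker[_ mi _]]]; exact: s mi.
- move=> X Y p /(ab_epi abP)[Z [g /G_coker[_ ep _]]]; exact: q ep.
- by move=> X Y Z i p /G_ker ki /G_coker ci; apply: e ki ci.
Qed.

Hypothesis sT : serre_for R T.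

Lemma exact_siso X Y (f : hom X Y) :
  siso P (fun X => T (G0 X)) f <-> siso R T (G f).
Proof.
split=> -[].
  move=> [K [k [/G_ker kk TK]]] [Q [q [/G_coker cq TQ]]].
  by split; [exists (G0 K), (G k)|exists (G0 Q), (G q)].
move=> mf ef; split.
  have [K [k kk]] := ab_ker abP f; exists K, k; split=> //.
  exact: (kernel_smono sT (G_ker kk) mf).
have [Q [q cq]] := ab_coker abP f; exists Q, q; split=> //.
exact: (@kernel_smono (op D) (op_add R) T (serre_for_op sT) _ _ (G f) _ (G q)
  (G_coker cq) ef).
Qed.

Lemma exact_isomorphic (X Y : C) :
  @isomorphic (serre_quotient (fun X => T (G0 X))) X Y ->
  @isomorphic (serre_quotient T) (G0 X) (G0 Y).
Proof.
apply: (isomorphic_localization (D := serre_quotient T) (G0 := G0)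
  (G1 := fun X Y f => loc_proj (@serre_iso D T) (G f))).
- by move=> Z; rewrite G_id loc_proj1.
- by move=> U V Z g f; rewrite G_comp loc_projM.
move=> U V w; rewrite (serre_iso_siso _ abP) => /exact_siso.
rewrite -(serre_iso_siso T abR) => Ww; exists (loc_inv Ww).
exact: loc_proj_inv.
Qed.

End ExactFunctor.

(** * Saturation of Serre subcategories *)

(** The additive structure of a full subcategory. *)
Definition sub_add (C : category) (P : preadditive C) (S : C -> Prop) :
    preadditive (full_subcategory S) :=
  @Preadditive (full_subcategory S) (fun X Y => zerom P (sval X) (sval Y))
    (fun X Y f => oppm P f) (fun X Y f g => addm P f g)
    (fun X Y => @addmA C P (sval X) (sval Y))
    (fun X Y => @addmC C P (sval X) (sval Y))
    (fun X Y => @add0m C P (sval X) (sval Y))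
    (fun X Y => @addNm C P (sval X) (sval Y))
    (fun X Y Z g g' f => compDm P g g' f)
    (fun X Y Z g f f' => compmD P g f f').

Section SubHalf.
Variables (C : category) (P : preadditive C) (S : C -> Prop).
Hypotheses (abP : abelian_for P) (sS : serre_for P S).
Local Notation L := (full_subcategory S).
Local Notation PL := (sub_add P S).

Lemma sub_monoP (X Y : L) (f : hom X Y) :
  mono f <-> mono (f : @hom C (sval X) (sval Y)).
Proof.
split=> mf; last by move=> Z g h; apply: mf.
have [K [k kk]] := ab_ker abP (f : @hom C (sval X) (sval Y)).
apply: (mono_kernel0 kk); have [fk mk _] := kk.
have SK : S K := sf_sub sS mk (svalP X).
by move/(monoP PL): mf => mf; apply: (mf (exist S K SK) k).
Qed.

Lemma kernel_sub (X Y : L) (f : hom X Y) (K : L) (k : hom K X) :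
  kernel P (f : @hom C (sval X) (sval Y)) k -> kernel PL f k.
Proof.
move=> [fk mk uk]; split=> //; first exact/sub_monoP.
by move=> T h /uk.
Qed.

(** The kernel of [f] in [C] lies in [S], hence is also a kernel in the
    subcategory, and kernels are unique. *)
Lemma sub_kernel (X Y : L) (f : hom X Y) (K : L) (k : hom K X) :
  kernel PL f k -> kernel P (f : @hom C (sval X) (sval Y)) k.
Proof.
move=> kk; have [M [m km]] := ab_ker abP (f : @hom C (sval X) (sval Y)).
have SM : S M by have [_ mm _] := km; apply: (sf_sub sS mm (svalP X)).
have km' : kernel PL (K := exist S M SM) f m by apply: kernel_sub.
have [u [v [mu vu uv]]] := kernel_uniq kk km'.
by have := kernel_iso km vu uv; rewrite -[k]mu.
Qed.

Lemma sub_ab_ker (X Y : L) (f : hom X Y) :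
  exists K (k : hom K X), kernel PL f k.
Proof.
have [K [k kk]] := ab_ker abP (f : @hom C (sval X) (sval Y)).
have SK : S K by have [_ mk _] := kk; apply: (sf_sub sS mk (svalP X)).
by exists (exist S K SK), k; apply: kernel_sub.
Qed.

Lemma sub_ab_mono (X Y : L) (f : hom X Y) : mono f ->
  exists Z (g : hom Y Z), kernel PL g f.
Proof.
move=> /sub_monoP mf.
have [Q [q cq]] := ab_coker abP (f : @hom C (sval X) (sval Y)).
have SQ : S Q by have [_ eq_ _] := cq; apply: (sf_quo sS eq_ (svalP Y)).
exists (exist S Q SQ), q; apply: kernel_sub.
exact: (mono_kernel_coker abP mf cq).
Qed.

End SubHalf.

Section Sub.
Variables (C : category) (P : preadditive C) (S : C -> Prop).
Hypotheses (abP : abelian_for P) (sS : serre_for P S).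
Local Notation L := (full_subcategory S).
Local Notation PL := (sub_add P S).
Let abO := abelian_for_op abP.
Let sO := serre_for_op sS.

Lemma sub_epiP (X Y : L) (f : hom X Y) :
  epi f <-> epi (f : @hom C (sval X) (sval Y)).
Proof. exact: (@sub_monoP (op C) (op_add P) S abO sO Y X f). Qed.

Lemma cokernel_sub (X Y : L) (f : hom X Y) (Q : L) (q : hom Y Q) :
  cokernel P (f : @hom C (sval X) (sval Y)) q -> cokernel PL f q.
Proof. exact: (@kernel_sub (op C) (op_add P) S abO sO Y X f Q q). Qed.

Lemma sub_cokernel (X Y : L) (f : hom X Y) (Q : L) (q : hom Y Q) :
  cokernel PL f q -> cokernel P (f : @hom C (sval X) (sval Y)) q.
Proof. exact: (@sub_kernel (op C) (op_add P) S abO sO Y X f Q q). Qed.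

Lemma sub_abelian : abelian_for PL.
Proof.
split.
- have [Z id0] := ab_zero abP.
  by exists (exist S Z (serre_zero sS id0)).
- move=> X Y.
  have [B [i1 [i2 [p1 [p2 [h1 h2 h3 h4 h5]]]]]] :=
    ab_biprod abP (sval X) (sval Y).
  (* [B] is an extension of [Y] by [X], so it lies in [S]. *)
  have ki : kernel P p2 i1.
    split=> //; first exact: mono_retract h1.
    move=> T h ph; exists (p1 \o h).
    by rewrite -[RHS]comp1m -h5 compDm -!compmA ph compm0 addm0.
  have SB : S B.
    apply: (serre_source (f := p2) abP sS _ (svalP Y)).
    by exists (sval X), i1; split=> //; exact: (svalP X).
  by exists (exist S B SB), i1, i2, p1, p2.
- exact: (sub_ab_ker abP sS).
- move=> X Y f; exact: (@sub_ab_ker (op C) (op_add P) S abO sO Y X f).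
- exact: (sub_ab_mono abP sS).
- move=> X Y f; exact: (@sub_ab_mono (op C) (op_add P) S abO sO Y X f).
Qed.

(** The image in [C] of a class of objects of the subcategory.  By proof
    irrelevance its preimage is the class itself. *)
Definition sub_image (K : L -> Prop) (X : C) := exists h : S X, K (exist S X h).

Lemma sub_imageE (K : L -> Prop) : (fun X : L => sub_image K (sval X)) = K.
Proof.
apply: functional_extensionality_dep => -[X h]; apply: propext.
by split=> [[h']|]; [rewrite (Prop_irrelevance h' h)|exists h].
Qed.

Lemma sub_image_serre (K : L -> Prop) :
  serre_for PL K -> serre_for P (sub_image K).
Proof.
case=> -[[X0 h0] K0] s q e; split.
- by exists X0, h0.
- move=> X Y i mi [hY KY]; have hX := sf_sub sS mi hY; exists hX.
  apply: (s (exist S X hX) (exist S Y hY) i) KY.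
  by apply/(sub_monoP abP sS).
- move=> X Y p ep [hX KX]; have hY := sf_quo sS ep hX; exists hY.
  apply: (q (exist S X hX) (exist S Y hY) p) KX.
  by apply/sub_epiP.
move=> X Y Z i p ki ci [hX KX] [hZ KZ].
have hY := sf_ext sS ki ci hX hZ; exists hY.
apply: (e (exist S X hX) (exist S Y hY) (exist S Z hZ) i p) => //.
  exact: kernel_sub.
exact: cokernel_sub.
Qed.

Lemma sub_saturated : saturated C -> saturated L.
Proof.
move=> satC K T.
have hz := abelian_for_zero abP; have hzL := abelian_for_zero sub_abelian.
move=> /(serreP PL _ hzL) sK /(serreP PL _ hzL) sT.
have sK' := sub_image_serre sK; have sT' := sub_image_serre sT.
have := satC _ _ ((serreP P _ hz).2 sK') ((serreP P _ hz).2 sT').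
set M := saturation _ _ => /(serreP P _ hz) sM.
have exact_incl := @exact_siso L C PL P (fun X => sval X) (fun X Y f => f)
  sub_abelian (sub_kernel abP sS) sub_cokernel _ sT'.
have -> : saturation T K = (fun X : L => M (sval X)).
  apply: functional_extensionality_dep => X; apply: propext; split.
    case=> Y [KY iXY]; exists (sval Y); split.
      by move: KY; rewrite -{1}(sub_imageE K).
    apply: (exact_isomorphic (P := PL) (R := P) (G0 := fun X : L => sval X)
      (G := fun X Y f => f)) => //.
    - exact: sub_abelian.
    - exact: sub_kernel.
    - exact: sub_cokernel.
    by rewrite sub_imageE.
  case=> Y [[SY KY] /(isomorphic_span abP sT')[Z [s [t [Ws Wt]]]]].
  (* The apex of the span is an extension of a subobject of [X] by a kernel
     lying in [S]. *)
  have SZ : S Z.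
    apply: (serre_source (f := s) abP sS _ (svalP X)).
    by have [[N [k [kk [SN _]]]] _] := Ws; exists N, k.
  exists (exist S Y SY); split=> //.
  have Ws' := (exact_incl (exist S Z SZ) X s).2 Ws.
  have Wt' := (exact_incl (exist S Z SZ) (exist S Y SY) t).2 Wt.
  rewrite sub_imageE in Ws' Wt'.
  apply: isomorphic_trans (siso_isomorphic sub_abelian Wt').
  exact: isomorphic_sym (siso_isomorphic sub_abelian Ws').
apply/(serreP PL _ hzL).
apply: (exact_serre (R := P) (G0 := fun X : L => sval X) (G := fun X Y f => f)).
- exact: sub_abelian.
- exact: sub_kernel.
- exact: sub_cokernel.
- exact: sM.
have [X KX] := sf_nonempty sK; exists X; apply: saturation_incl.
by rewrite -(sub_imageE K) in KX.
Qed.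

End Sub.

(** * Saturation of Serre quotients *)

Section QuotientSaturated.
Variables (C D : category) (P : preadditive C) (R : preadditive D).
Variables (S : C -> Prop).
Variables (F0 : C -> D) (F : forall X Y : C, hom X Y -> hom (F0 X) (F0 Y)).
Hypotheses (abP : abelian_for P) (sS : serre_for P S).
Hypothesis fr : fractions (siso P S) F.
Hypothesis F_add : forall X Y (f g : hom X Y),
  F (addm P f g) = addm R (F f) (F g).

Let abR : abelian_for R := quotient_abelian abP sS fr F_add.
Let WP X Y (f : hom X Y) : siso P S f <-> siso P S f.
Proof. by []. Qed.
Let F_ker := functor_kernel fr F_add.
Let F_coker := functor_cokernel fr F_add.

(** A Serre subcategory [M] containing [S] descends to the quotient: morphisms
    of the quotient become fractions, and [M] contains one end of a morphism
    inverted for [S] as soon as it contains the other. *)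
Lemma quotient_serre (M : C -> Prop) (N : D -> Prop) :
  serre_for P M -> (forall X, S X -> M X) ->
  (forall X, N (F0 X) <-> M X) -> serre_for R N.
Proof.
move=> sM SM NM.
have smonoM X Y (f : hom X Y) : smono P S f -> smono P M f.
  by case=> K [k [kk /SM]]; exists K, k.
have sepiM X Y (f : hom X Y) : sepi P S f -> sepi P M f.
  by case=> K [k [kk /SM]]; exists K, k.
have subN X Y (i : hom X Y) : mono i -> N Y -> N X.
  have [X' eX] := fr_surj fr X; have [Y' eY] := fr_surj fr Y.
  case: X / eX i => i; case: Y / eY i => i mi /NM MY; apply/NM.
  have [Z [s [f [Ws fE]]]] := fr_right fr i; have [v [vs _]] := fr_inv fr Ws.
  have /smonoM mf : smono P S f.
    apply: (functor_mono_smono abP sS WP fr F_add); rewrite -fE.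
    exact: mono_comp (mono_retract vs).
  have [_ /sepiM es] := Ws.
  exact: (serre_target abP sM es (serre_source abP sM mf MY)).
split=> //.
- by have [X /NM] := sf_nonempty sM; exists (F0 X).
- move=> X Y p; have [X' eX] := fr_surj fr X; have [Y' eY] := fr_surj fr Y.
  case: X / eX p => p; case: Y / eY p => p ep /NM MX; apply/NM.
  have [Z [s [f [Ws fE]]]] := fr_left fr p; have [v [_ sv]] := fr_inv fr Ws.
  have /sepiM ef : sepi P S f.
    have ef : epi (F f).
      rewrite -fE => T g h; rewrite !compmA => /ep /(congr1 (fun k => k \o v)).
      by rewrite -!compmA sv !compm1.
    exact: (functor_epi_sepi abP sS fr F_add ef).
  have [/smonoM ms _] := Ws.
  exact: (serre_source abP sM ms (serre_target abP sM ef MX)).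
move=> X Y Z i p; have [Y' eY] := fr_surj fr Y; have [Z' eZ] := fr_surj fr Z.
case: Y / eY i p => i p; case: Z / eZ p => p ki _ NX /NM MZ; apply/NM.
have [T [s [f [Ws fE]]]] := fr_right fr p; have [v [vs sv]] := fr_inv fr Ws.
have [K [k kk]] := ab_ker abP f.
have kp : kernel R p (F s \o F k).
  by apply: kernel_iso_pre vs sv _; rewrite fE; apply: F_ker kk.
have MK : M K.
  have [u [w [_ wu uw]]] := kernel_uniq kp ki.
  by apply/NM; apply: subN (mono_retract wu) NX.
have mf : smono P M f by exists K, k.
have [_ /sepiM es] := Ws.
exact: (serre_target abP sM es (serre_source abP sM mf MZ)).
Qed.

(** A morphism [a] of the quotient with kernel and cokernel in [T] is a fraction
    of two morphisms of [C] with kernel and cokernel in the preimage of [T]. *)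
Lemma quotient_siso_isomorphic (T : D -> Prop) (X Y : C)
    (a : hom (F0 X) (F0 Y)) :
  serre_for R T -> siso R T a ->
  @isomorphic (serre_quotient (fun X => T (F0 X))) X Y.
Proof.
move=> sT Ta; set T' := fun X => T (F0 X).
have exF := @exact_siso _ _ _ _ _ _ abP F_ker F_coker _ sT.
have sT' : serre_for P T'.
  apply: (exact_serre abP F_ker F_coker sT).
  have [X0] := sf_nonempty sT; have [X1 <-] := fr_surj fr X0.
  by exists X1.
have [Z [s [f [Ws fE]]]] := fr_right fr a; have [v [vs sv]] := fr_inv fr Ws.
have Ts : siso R T (F s).
  split; first exact: (mono_smono abR sT (mono_retract vs)).
  apply: (epi_sepi abR sT) => U g h /(congr1 (fun k => k \o v)).
  by rewrite -!compmA sv !compm1.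
have Tf : siso R T (F f) by rewrite -fE; apply: siso_comp.
move/exF: Ts; move/exF: Tf => /(siso_isomorphic abP) iZY /(siso_isomorphic abP).
by move/isomorphic_sym=> iXZ; apply: isomorphic_trans iXZ iZY.
Qed.

Lemma quotient_saturated : saturated C -> saturated D.
Proof.
move=> satC K T.
have hz := abelian_for_zero abP; have hzD := abelian_for_zero abR.
move=> /(serreP R _ hzD) sK /(serreP R _ hzD) sT; apply/(serreP R _ hzD).
have pull U : serre_for R U -> serre_for P (fun X => U (F0 X)).
  move=> sU; apply: (exact_serre abP F_ker F_coker sU).
  have [X0] := sf_nonempty sU; have [X1 <-] := fr_surj fr X0.
  by exists X1.
have sK' := pull K sK; have sT' := pull T sT.
have := satC _ _ ((serreP P _ hz).2 sK') ((serreP P _ hz).2 sT').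
set M := saturation _ _ => /(serreP P _ hz) sM.
apply: (quotient_serre sM) => X.
  (* An object of [S] vanishes in the quotient, hence lies in [K]. *)
  move=> SX; apply: saturation_incl.
  exact: (serre_zero sK (functor_obj0 abP sS WP fr F_add SX)).
split=> -[Y [KY iXY]].
  have [Y' eY] := fr_surj fr Y; case: Y / eY KY iXY => KY.
  move=> /(isomorphic_span abR sT)[Z].
  have [Z' eZ] := fr_surj fr Z; case: Z / eZ => -[s [t [Ws Wt]]].
  exists Y'; split=> //.
  apply: isomorphic_trans (quotient_siso_isomorphic sT Wt).
  exact: isomorphic_sym (quotient_siso_isomorphic sT Ws).
exists (F0 Y); split=> //.
exact: (exact_isomorphic abP abR (fr_id fr) (fr_comp fr) F_ker F_coker sT iXY).
Qed.

End QuotientSaturated.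

Theorem proposition8p16 (A : category) (S : A -> Prop) :
  abelian A -> saturated A -> serre S ->
  (abelian (full_subcategory S) /\ saturated (full_subcategory S)) /\
  (abelian (serre_quotient S) /\ saturated (serre_quotient S)).
Proof.
move=> /abelianP[P abP] satA /(serreP P _ (abelian_for_zero abP)) sS.
have fr := siso_fractions abP sS.
have [R F_add] := serre_quotient_preadditive abP sS.
split; split.
- by apply/abelianP; exists (sub_add P S); apply: sub_abelian.
- exact: (sub_saturated abP sS).
- by apply/abelianP; exists R; apply: (quotient_abelian abP sS fr).
exact: (quotient_saturated abP sS fr F_add).
Qed.
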